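(* Let $K\ge 1$, $K'\ge 0$ and let $f=h+\overline{g}$ (with $h,g$ analytic in $\mathbb{D}$) be a $(K,K')$-elliptic harmonic mapping defined on the unit disc $\mathbb{D}$ such that $f(0)=0$, $\lambda_f(0)=1$ and $\lambda_f(z)\le\lambda$ for all $z\in\mathbb{D}$, where $\lambda$ is a constant. Then $f$ is univalent on the disc $\mathbb{D}_{\rho_1}$ with $$\rho_1=\rho_1(\lambda)=\frac{1}{1+K\lambda+\sqrt{K'}},$$ and $f(\mathbb{D}_{\rho_1})$ contains a schlicht disc with radius $$R_1=\rho_1(\lambda)+\left(K\lambda+\sqrt{K'}\right)\left(\rho_1(\lambda)+\ln\left(\left(K\lambda+\sqrt{K'}\right)\rho_1(\lambda)\right)\right).$$
   Context: $\mathbb{D}=\{z\in\mathbb{C}:|z|<1\}$ and $\mathbb{D}_r=\{z\in\mathbb{C}:|z|<r\}$. Univalent means one-to-one. A schlicht disc in the image of a region under $f$ is an open disc that is the one-to-one image under $f$ of some subdomain of that region. A complex-valued function $f=u+iv$ is harmonic if $u$ and $v$ are real-valued harmonic functions. For a continuously differentiable $f$, put $\Lambda_f=|f_z|+|f_{\bar z}|$, $\lambda_f=\big||f_z|-|f_{\bar z}|\big|$, and $J_f=|f_z|^2-|f_{\bar z}|^2$ (the Jacobian). A harmonic function $f$ is sense-preserving if $J_f(z)>0$ in its domain. A function is $ACL$ in a domain $\Omega$ if for every closed rectangle $R\subset\Omega$ with sides parallel to the axes it is absolutely continuous on almost every horizontal and almost every vertical line in $R$; it is $ACL^2$ if moreover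 its partial derivatives are locally $L^2$ in $\Omega$. A sense-preserving continuous mapping $f:\mathbb{D}\to\mathbb{C}$ is $(K,K')$-elliptic, where $K\ge1$ and $K'\ge0$ are constants, if (1) $f$ is $ACL^2$ in $\mathbb{D}$ and $J_f\ne0$ a.e. in $\mathbb{D}$, and (2) $\|D_f\|^2\le K J_f+K'$ a.e. in $\mathbb{D}$, where $\|D_f\|=\Lambda_f$. *)

(* Defs.v *)
(* The complex plane is Coquelicot's C = R * R over Stdlib's real numbers;
   Lebesgue measure, topology and sets on R * R come from MathComp-Analysis. *)
From HB Require Import structures.
From Stdlib Require Import Reals.
From Coquelicot Require Import Hierarchy Derive Derive_2d Complex.
From mathcomp Require Import all_boot all_order all_algebra.
From mathcomp Require Import all_classical all_reals all_analysis.
From mathcomp Require Import Rstruct Rstruct_topology.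

Set Implicit Arguments.
Unset Strict Implicit.
Unset Printing Implicit Defensive.

Import numFieldNormedType.Exports.

Local Open Scope classical_set_scope.
Local Open Scope R_scope.

(* Functions on a region are total functions constrained on that region only. *)

Definition Cdisc (r : R) : set C := [set z | Cmod z < r].

Definition lebesgue1 : set (measurableTypeR R) -> \bar R := @lebesgue_measure R.

(* R * R with the product of the Borel sigma-algebras. *)
Definition plane : Type := (measurableTypeR R * measurableTypeR R)%type.

Definition lebesgue2 : set plane -> \bar R :=
  (@lebesgue_measure R \x @lebesgue_measure R)%E.

(* A nonempty connected open set. *)
Definition is_domain (G : set (R * R)) : Prop :=
  [/\ G !=set0, open G & connected G].

Definition univalent (U : set C) (f : C -> C) : Prop :=
  forall z1 z2, U z1 -> U z2 -> f z1 = f z2 -> z1 = z2.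

Definition has_schlicht_disc (f : C -> C) (U : set C) (r : R) : Prop :=
  exists (w0 : C) (G : set C),
    [/\ G `<=` U, is_domain G, univalent G f &
        f @` G = [set w | Cmod (w - w0) < r]].

Definition analytic (U : set C) (h : C -> C) : Prop :=
  forall z, U z -> @Derive.ex_derive C_AbsRing C_NormedModule h z.

Definition Dx (f : C -> C) (z : C) : C :=
  (Derive (fun t => Re (f (t, Im z))) (Re z),
   Derive (fun t => Im (f (t, Im z))) (Re z)).

Definition Dy (f : C -> C) (z : C) : C :=
  (Derive (fun t => Re (f (Re z, t))) (Im z),
   Derive (fun t => Im (f (Re z, t))) (Im z)).

Definition Dz (f : C -> C) (z : C) : C := ((Dx f z - Ci * Dy f z) / 2)%C.

Definition Dzbar (f : C -> C) (z : C) : C := ((Dx f z + Ci * Dy f z) / 2)%C.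

Definition Lambda (f : C -> C) (z : C) : R := Cmod (Dz f z) + Cmod (Dzbar f z).

Definition lambda (f : C -> C) (z : C) : R :=
  Rabs (Cmod (Dz f z) - Cmod (Dzbar f z)).

Definition Jacobian (f : C -> C) (z : C) : R :=
  Cmod (Dz f z) ^ 2 - Cmod (Dzbar f z) ^ 2.

(* [ex_diff_n u 2] at every point of an open set is C^2 regularity there. *)
Definition real_harmonic (U : set C) (u : R -> R -> R) : Prop :=
  forall z, U z ->
    ex_diff_n u 2 (Re z) (Im z) /\
    partial_derive 2 0 u (Re z) (Im z) + partial_derive 0 2 u (Re z) (Im z) = 0.

Definition harmonic_map (U : set C) (f : C -> C) : Prop :=
  real_harmonic U (fun x y => Re (f (x, y))) /\
  real_harmonic U (fun x y => Im (f (x, y))).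

(* The pointwise notion for harmonic maps, whose Jacobian is classical. *)
Definition sense_preserving (U : set C) (f : C -> C) : Prop :=
  forall z, U z -> 0 < Jacobian f z.

Definition abs_continuous (a b : R) (g : R -> C) : Prop :=
  forall eps, 0 < eps -> exists delta, 0 < delta /\
    forall (n : nat) (s t : 'I_n -> R),
      (forall i, a <= s i /\ s i <= t i /\ t i <= b) ->
      (forall i j, i <> j -> t i <= s j \/ t j <= s i) ->
      \big[Rplus/0]_(i < n) (t i - s i) < delta ->
      \big[Rplus/0]_(i < n) Cmod (g (t i) - g (s i)) < eps.

Definition ACL (U : set C) (f : C -> C) : Prop :=
  forall a b c d, a < b -> c < d ->
    (forall x y, a <= x <= b -> c <= y <= d -> U (x, y)) ->
    {ae lebesgue1, forall y, c <= y <= d -> abs_continuous a b (fun x => f (x, y))} /\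
    {ae lebesgue1, forall x, a <= x <= b -> abs_continuous c d (fun y => f (x, y))}.

(* Same shape as MathComp-Analysis's one-dimensional [locally_integrable]. *)
Definition locally_L2 (U : set plane) (g : plane -> measurableTypeR R) : Prop :=
  measurable_fun U g /\
  forall A : set (R * R), A `<=` U -> compact A ->
    (\int[lebesgue2]_(z in A) (Rsqr (g z))%:E < +oo)%E.

Definition ACL2 (U : set C) (f : C -> C) : Prop :=
  [/\ ACL U f,
      locally_L2 U (fun z => Re (Dx f z)), locally_L2 U (fun z => Im (Dx f z)),
      locally_L2 U (fun z => Re (Dy f z)) & locally_L2 U (fun z => Im (Dy f z))].

Definition elliptic (K K' : R) (f : C -> C) : Prop :=
  [/\ forall z, Cdisc 1 z -> {for z, continuous (f : R * R -> R * R)},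
      sense_preserving (Cdisc 1) f,
      ACL2 (Cdisc 1) f,
      {ae lebesgue2, forall z, Cdisc 1 z -> Jacobian f z <> 0} &
      {ae lebesgue2, forall z, Cdisc 1 z ->
         Lambda f z ^ 2 <= K * Jacobian f z + K'}].

Definition rho1 (K K' lam : R) : R := 1 / (1 + K * lam + sqrt K').

Definition schlicht_radius (K K' lam : R) : R :=
  rho1 K K' lam +
  (K * lam + sqrt K') *
    (rho1 K K' lam + Rpower.ln ((K * lam + sqrt K') * rho1 K K' lam)).

(* Main.v *)
(* With [M = K lam + sqrt K'], ellipticity and [J = Lambda lambda] give
   [Lambda <= M] on the disc, first almost everywhere and then everywhere by
   continuity.  For vectors [e] and [d], the inner product of [e] with the
   derivative of [f] in the direction [d] is the real part of a holomorphic
   function bounded by [|e| |d| M], so Cauchy's formula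
     [F(z) - F(0) = 1/(2 pi) int F(s e^(it)) z / (s e^(it) - z) dt]
   bounds its variation between 0 and [z] by [|e| |d| M |z| / (1 - |z|)].
   Hence [f - Df(0)] has Lipschitz constant [M r / (1 - r)] on [|z| <= r], which
   is less than 1 for [r < 1 / (1 + M)], while [|Df(0) d| >= |d|].  This yields
   injectivity, and surjectivity onto discs follows from the contraction
   [z |-> Df(0)^-1 (w - (f - Df(0)) z)]. *)

From mathcomp Require Import all_boot all_order all_algebra.
From mathcomp Require Import all_classical all_reals all_analysis.
From mathcomp Require Import Rstruct Rstruct_topology.
From Stdlib Require Import Reals Lra.
From Coquelicot Require Import Rcomplements Hierarchy Continuity Derive Derive_2d.
From Coquelicot Require Import Complex RInt RInt_analysis AutoDerive.
Require Import Defs.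

Local Open Scope R_scope.

(** * Cauchy's formula and growth of bounded holomorphic functions *)

(** Both constants come from one function. On [|z| <= x] the map expands distances by at least the
    factor [1 - M x / (1 - x)]. This factor vanishes exactly at [x = 1 / (1 + M)], and its integral
    from 0 to that point, [x + M (x + ln (1 - x))], is the radius of the schlicht disc; it takes the
    stated form because [1 - x = M x] there. Since the factor degenerates at the critical radius,
    quantitative estimates are made on smaller closed discs, which exhaust the open one. Holomorphic
    functions enter as gradients [u_x - i u_y] of real harmonic [u], kept as pairs of real
    functions. Cauchy's formula then concerns real integrals only, and is proved by shrinking the
    circle to a point while the kernel stays fixed. A schlicht disc also needs a connected region
    above it: this is the preimage of the disc, swept out by lifts of its radii. *)

Lemma continuity_2d_pt_comp (f g h : R -> R -> R) (x y : R) :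
  continuity_2d_pt f (g x y) (h x y) ->
  continuity_2d_pt g x y -> continuity_2d_pt h x y ->
  continuity_2d_pt (fun u v => f (g u v) (h u v)) x y.
Proof.
move=> Hf Hg Hh eps.
case: (Hf eps) => d Hd.
case: (Hg d) => d1 H1; case: (Hh d) => d2 H2.
have Hm : 0 < Rmin d1 d2 by apply: Rmin_pos; apply: cond_pos.
exists (mkposreal _ Hm) => u v /= Hu Hv.
by apply: Hd; [apply: H1|apply: H2];
  (apply: Rlt_le_trans; [eassumption|]);
  first [exact: Rmin_l|exact: Rmin_r].
Qed.

Lemma continuity_2d_pt_slice (f : R -> R -> R) (x y : R) :
  continuity_2d_pt f x y -> continuous (fun t => f x t) y.
Proof.
move=> Hf; apply/continuity_pt_filterlim => eps Heps.
case: (Hf (mkposreal _ Heps)) => d Hd.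
exists d; split; first exact: cond_pos.
move=> t [_ Ht]; apply: (Hd x t) => //.
by rewrite Rminus_diag Rabs_R0; apply: cond_pos.
Qed.

Lemma continuity_2d_pt_snd (k : R -> R) (x y : R) :
  ex_derive k y -> continuity_2d_pt (fun _ v => k v) x y.
Proof.
move=> Hk; apply: (continuity_1d_2d_pt_comp k (fun _ v => v)).
  by apply/continuity_pt_filterlim; apply: ex_derive_continuous.
exact: continuity_2d_pt_id2.
Qed.

(* [A + i B] is holomorphic in the unit disc with continuous derivative
   [A1 - i A2]. *)
Definition holomorphic_pair (A B : R -> R -> R) : Prop :=
  exists A1 A2 : R -> R -> R, forall x y, x * x + y * y < 1 ->
    [/\ continuity_2d_pt A1 x y, continuity_2d_pt A2 x y,
        differentiable_pt_lim A x y (A1 x y) (A2 x y) &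
        differentiable_pt_lim B x y (- A2 x y) (A1 x y)].

(* The point [r e^(i a) + l (s e^(i (t + a)) - r e^(i a))], which moves from
   [r e^(i a)] to the circle of radius [s] as [l] runs from 0 to 1. *)
Definition homotopy_x (r s a l t : R) : R :=
  r * cos a + l * (s * cos (t + a) - r * cos a).
Definition homotopy_y (r s a l t : R) : R :=
  r * sin a + l * (s * sin (t + a) - r * sin a).

(* Real and imaginary parts of [r / (s e^(i t) - r)]. *)
Definition kernel_den (r s t : R) : R := s * s - 2 * r * s * cos t + r * r.
Definition kernel_re (r s t : R) : R :=
  (r * s * cos t - r * r) / kernel_den r s t.
Definition kernel_im (r s t : R) : R :=
  - (r * s * sin t) / kernel_den r s t.

Lemma cos_sq_sin_sq (t : R) : cos t * cos t + sin t * sin t = 1.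
Proof. by have := sin2_cos2 t; rewrite /Rsqr; lra. Qed.

Lemma kernel_den_ge (r s t : R) :
  0 <= r -> 0 <= s -> (s - r) * (s - r) <= kernel_den r s t.
Proof.
move=> Hr Hs; rewrite /kernel_den.
have [_ Hc] := COS_bound t.
have : r * s * cos t <= r * s * 1.
  by apply: Rmult_le_compat_l => //; apply: Rmult_le_pos.
lra.
Qed.

Lemma kernel_den_pos (r s t : R) : 0 <= r < s -> 0 < kernel_den r s t.
Proof.
move=> Hr; apply: Rlt_le_trans (kernel_den_ge _ _ t _ _); try lra.
by apply: Rmult_lt_0_compat; lra.
Qed.

(** The point is [(1 - l) r e^(i a) + l s e^(i (t + a))], of modulus at most [(|1 - l| + |l|) s],
    which leaves room for a margin [(1 - s) / 3] beyond both ends of [0 <= l <= 1]. The margin makes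
    two-sided derivatives in [l] available at the ends. *)
Lemma homotopy_in_disc (r s a l t : R) : 0 <= r < s -> s < 1 ->
  - ((1 - s) / 3) < l < 1 + (1 - s) / 3 ->
  homotopy_x r s a l t * homotopy_x r s a l t
  + homotopy_y r s a l t * homotopy_y r s a l t < 1.
Proof.
move=> Hr Hs Hl.
set p := (1 - l) * r; set q := l * s.
have -> : homotopy_x r s a l t * homotopy_x r s a l t
  + homotopy_y r s a l t * homotopy_y r s a l t
  = p * p + q * q + 2 * (p * q) * cos t.
  have -> : cos t = cos (t + a) * cos a + sin (t + a) * sin a.
    by rewrite -cos_minus; congr cos; ring.
  have E1 := cos_sq_sin_sq a; have E2 := cos_sq_sin_sq (t + a).
  rewrite /homotopy_x /homotopy_y.
  transitivity (p * p * (cos a * cos a + sin a * sin a)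
    + q * q * (cos (t + a) * cos (t + a) + sin (t + a) * sin (t + a))
    + 2 * (p * q) * (cos (t + a) * cos a + sin (t + a) * sin a)).
    by rewrite /p /q; ring.
  by rewrite E1 E2; ring.
have Hpq : Rabs p + Rabs q < 1.
  have H : 2 * ((1 - s) / 3) * s < 1 - s.
    have : (1 - s) * s < (1 - s) * 1 by apply: Rmult_lt_compat_l; lra.
    lra.
  have Hr1 : 0 <= (1 - s) / 3 by lra.
  rewrite /p /q !Rabs_mult (Rabs_pos_eq r) ?(Rabs_pos_eq s); try lra.
  have : Rabs (1 - l) * r <= Rabs (1 - l) * s.
    by apply: Rmult_le_compat_l; [apply: Rabs_pos|lra].
  have : (Rabs (1 - l) + Rabs l) * s <= (1 + 2 * ((1 - s) / 3)) * s.
    by apply: Rmult_le_compat_r; [lra|split_Rabs; lra].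
  lra.
have Hc : (p * q) * cos t <= Rabs p * Rabs q.
  rewrite -Rabs_mult; apply: Rle_trans (Rle_abs _) _.
  rewrite Rabs_mult -{2}(Rmult_1_r (Rabs (p * q))).
  apply: Rmult_le_compat_l; first exact: Rabs_pos.
  by apply: Rabs_le; apply: COS_bound.
have -> : p * p + q * q = Rabs p * Rabs p + Rabs q * Rabs q.
  by rewrite -!Rabs_mult !Rabs_pos_eq //; nra.
have := Rabs_pos p; have := Rabs_pos q.
nra.
Qed.

Lemma is_derive_homotopy_x_l (r s a l t : R) :
  is_derive (fun u => homotopy_x r s a u t) l (s * cos (t + a) - r * cos a).
Proof. by rewrite /homotopy_x; auto_derive => //; ring. Qed.

Lemma is_derive_homotopy_y_l (r s a l t : R) :
  is_derive (fun u => homotopy_y r s a u t) l (s * sin (t + a) - r * sin a).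
Proof. by rewrite /homotopy_y; auto_derive => //; ring. Qed.

Lemma is_derive_homotopy_x_t (r s a l t : R) :
  is_derive (homotopy_x r s a l) t (- (l * s * sin (t + a))).
Proof. by rewrite /homotopy_x; auto_derive => //; ring. Qed.

Lemma is_derive_homotopy_y_t (r s a l t : R) :
  is_derive (homotopy_y r s a l) t (l * s * cos (t + a)).
Proof. by rewrite /homotopy_y; auto_derive => //; ring. Qed.

Lemma ex_derive_kernel_re (r s t : R) : 0 <= r < s ->
  ex_derive (kernel_re r s) t.
Proof.
move=> Hr; have := kernel_den_pos r s t Hr.
by rewrite /kernel_re /kernel_den => H; auto_derive; lra.
Qed.

Lemma ex_derive_kernel_im (r s t : R) : 0 <= r < s ->
  ex_derive (kernel_im r s) t.
Proof.
move=> Hr; have := kernel_den_pos r s t Hr.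
by rewrite /kernel_im /kernel_den => H; auto_derive; lra.
Qed.

Lemma ex_derive_cos_add (a t : R) : ex_derive (fun t => cos (t + a)) t.
Proof. by auto_derive. Qed.

Lemma ex_derive_sin_add (a t : R) : ex_derive (fun t => sin (t + a)) t.
Proof. by auto_derive. Qed.

Lemma kernel_modulus_le (r s t : R) : 0 <= r < s ->
  kernel_re r s t * kernel_re r s t + kernel_im r s t * kernel_im r s t
  <= (r / (s - r)) * (r / (s - r)).
Proof.
move=> Hr; have HD := kernel_den_pos r s t Hr.
have -> : kernel_re r s t * kernel_re r s t
    + kernel_im r s t * kernel_im r s t = (r * r) / kernel_den r s t.
  rewrite /kernel_re /kernel_im.
  have E : (r * s * cos t - r * r) * (r * s * cos t - r * r)
      + (r * s * sin t) * (r * s * sin t) = r * r * kernel_den r s t.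
    transitivity (r * r * (s * s * (cos t * cos t + sin t * sin t)
      - 2 * r * s * cos t + r * r)); first ring.
    by rewrite cos_sq_sin_sq /kernel_den; ring.
  transitivity (((r * s * cos t - r * r) * (r * s * cos t - r * r)
      + (r * s * sin t) * (r * s * sin t))
      / (kernel_den r s t * kernel_den r s t)); first by field; lra.
  by rewrite E; field; lra.
have -> : (r / (s - r)) * (r / (s - r)) = (r * r) / ((s - r) * (s - r)).
  by field; lra.
apply: Rmult_le_compat_l; first nra.
apply: Rinv_le_contravar; first by apply: Rmult_lt_0_compat; lra.
by apply: kernel_den_ge; lra.
Qed.

(* The antiderivatives are the two components of [log (s - r e^(- i t))]. *)
Lemma is_RInt_kernel_re (r s : R) : 0 <= r < s ->
  is_RInt (kernel_re r s) 0 (2 * PI) 0.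
Proof.
move=> Hr.
(* The real part of [s - r e^(- i t)] stays positive, so [atan] gives one smooth branch of the
   argument over the whole period. *)
have Hpos t : 0 < s - r * cos t by have := COS_bound t; nra.
have H := is_RInt_derive (fun t => atan (r * sin t / (s - r * cos t)))
  (kernel_re r s) 0 (2 * PI).
have E : minus (atan (r * sin (2 * PI) / (s - r * cos (2 * PI))))
          (atan (r * sin 0 / (s - r * cos 0))) = 0.
  by rewrite sin_2PI cos_2PI sin_0 cos_0 /minus /plus /opp /=; ring.
rewrite -[X in is_RInt _ _ _ X]E; apply: H.
- move=> t _; have HD := kernel_den_pos r s t Hr; have Ht := Hpos t.
  auto_derive; first lra.
  rewrite /kernel_re /kernel_den.
  have Ec := cos_sq_sin_sq t.
  have E1 : s * s - 2 * r * s * cos t + r * r =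
      (s - r * cos t) * (s - r * cos t) + r * sin t * (r * sin t).
    by transitivity (s * s - 2 * r * s * cos t
      + r * r * (cos t * cos t + sin t * sin t)); [rewrite Ec; ring|ring].
  rewrite /kernel_den in HD.
  have E2 : r * s * cos t - r * r =
     r * cos t * (s - r * cos t) - r * sin t * (r * sin t).
    by transitivity (r * s * cos t
      - r * r * (cos t * cos t + sin t * sin t)); [rewrite Ec; ring|ring].
  rewrite E1 E2; rewrite E1 in HD.
  by field; split; nra.
- by move=> t _; apply: ex_derive_continuous; apply: ex_derive_kernel_re.
Qed.

Lemma is_RInt_kernel_im (r s : R) : 0 <= r < s ->
  is_RInt (kernel_im r s) 0 (2 * PI) 0.
Proof.
move=> Hr.
have H := is_RInt_derive (fun t => - (/ 2) * ln (kernel_den r s t))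
  (kernel_im r s) 0 (2 * PI).
have E : minus (- (/ 2) * ln (kernel_den r s (2 * PI)))
          (- (/ 2) * ln (kernel_den r s 0)) = 0.
  by rewrite /kernel_den cos_2PI cos_0 /minus /plus /opp /=; ring.
rewrite -[X in is_RInt _ _ _ X]E; apply: H.
- move=> t _; have HD := kernel_den_pos r s t Hr.
  rewrite /kernel_im /kernel_den in HD *.
  auto_derive; first lra.
  by field; lra.
- by move=> t _; apply: ex_derive_continuous; apply: ex_derive_kernel_im.
Qed.

Lemma continuity_2d_pt_homotopy (f : R -> R -> R) (r s a l t : R) :
  continuity_2d_pt f (homotopy_x r s a l t) (homotopy_y r s a l t) ->
  continuity_2d_pt
    (fun u v => f (homotopy_x r s a u v) (homotopy_y r s a u v)) l t.
Proof.
move=> Hf; apply: continuity_2d_pt_comp => //; rewrite /homotopy_x /homotopy_y.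
all: apply: continuity_2d_pt_plus; first exact: continuity_2d_pt_const.
all: apply: continuity_2d_pt_mult; first exact: continuity_2d_pt_id1.
all: apply: (continuity_2d_pt_snd (fun v => _)); by auto_derive.
Qed.

Lemma is_derive_comp_2d (f : R -> R -> R) (g h : R -> R) (x lx ly dg dh : R) :
  differentiable_pt_lim f (g x) (h x) lx ly ->
  is_derive g x dg -> is_derive h x dh ->
  is_derive (fun t => f (g t) (h t)) x (lx * dg + ly * dh).
Proof.
move=> Hf /is_derive_Reals Hg /is_derive_Reals Hh; apply/is_derive_Reals.
exact: derivable_pt_lim_comp_2d.
Qed.

Lemma differentiable_pt_lim_continuity (f : R -> R -> R) (x y lx ly : R) :
  differentiable_pt_lim f x y lx ly -> continuity_2d_pt f x y.
Proof.
by move=> H; apply: differentiable_continuity_pt; exists lx, ly.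
Qed.

(** With [F = A + i B] and [k = r / (s e^(i t) - r)], this is the real part of [F (1 + k)]. As
    [1 + k = s e^(i t) / (s e^(i t) - r)], the case [l = 1] is Cauchy's integrand for the point
    [r e^(i a)]; only the argument of [F] moves with [l]. *)
Definition cauchy_integrand (A B : R -> R -> R) (r s a l t : R) : R :=
  A (homotopy_x r s a l t) (homotopy_y r s a l t) * (1 + kernel_re r s t)
  - B (homotopy_x r s a l t) (homotopy_y r s a l t) * kernel_im r s t.

Lemma ex_RInt_cauchy_integrand (A B : R -> R -> R) (r s a l : R) :
  holomorphic_pair A B -> 0 <= r < s -> s < 1 ->
  - ((1 - s) / 3) < l < 1 + (1 - s) / 3 ->
  ex_RInt (cauchy_integrand A B r s a l) 0 (2 * PI).
Proof.
move=> [A1 [A2 HAB]] Hr Hs Hl; apply: ex_RInt_continuous => t _.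
apply: (continuity_2d_pt_slice (cauchy_integrand A B r s a)).
have [_ _ HA HB] := HAB _ _ (homotopy_in_disc r s a l t Hr Hs Hl).
rewrite /cauchy_integrand; apply: continuity_2d_pt_minus;
  apply: continuity_2d_pt_mult.
- apply: continuity_2d_pt_homotopy.
  exact: differentiable_pt_lim_continuity HA.
- apply: continuity_2d_pt_plus; first exact: continuity_2d_pt_const.
  by apply: continuity_2d_pt_snd; apply: ex_derive_kernel_re.
- apply: continuity_2d_pt_homotopy.
  exact: differentiable_pt_lim_continuity HB.
- by apply: continuity_2d_pt_snd; apply: ex_derive_kernel_im.
Qed.

(** Real and imaginary parts of [(s e^(i t) - r) (1 + k) = s e^(i t)]: the velocity of the homotopy
    in [l] cancels the denominator of the kernel. *)
Lemma kernel_mul (r s t : R) : 0 <= r < s ->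
  (s * cos t - r) * (1 + kernel_re r s t) - s * sin t * kernel_im r s t
  = s * cos t /\
  (s * cos t - r) * kernel_im r s t + s * sin t * (1 + kernel_re r s t)
  = s * sin t.
Proof.
move=> Hr; have HD := kernel_den_pos r s t Hr.
have ED : kernel_den r s t
    = (s * cos t - r) * (s * cos t - r) + s * sin t * (s * sin t).
  transitivity (s * s * (cos t * cos t + sin t * sin t)
    - 2 * r * s * cos t + r * r); last ring.
  by rewrite cos_sq_sin_sq /kernel_den; ring.
have E1 : kernel_re r s t * kernel_den r s t = r * (s * cos t - r).
  by rewrite /kernel_re; field; lra.
have E2 : kernel_im r s t * kernel_den r s t = - (r * (s * sin t)).
  by rewrite /kernel_im; field; lra.
split; apply: (Rmult_eq_reg_r (kernel_den r s t)); try lra.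
- transitivity ((s * cos t - r) * (kernel_den r s t
    + kernel_re r s t * kernel_den r s t)
    - s * sin t * (kernel_im r s t * kernel_den r s t)); first ring.
  by rewrite E1 E2 ED; ring.
- transitivity ((s * cos t - r) * (kernel_im r s t * kernel_den r s t)
    + s * sin t * (kernel_den r s t + kernel_re r s t * kernel_den r s t)).
    by ring.
  by rewrite E1 E2; ring.
Qed.

(* The integral is constant along the homotopy because the [l]-derivative of
   its integrand is [1/l] times the [t]-derivative of [B]. *)
Lemma RInt_cauchy_integrand_const (A B : R -> R -> R) (r s a : R) :
  holomorphic_pair A B -> 0 <= r < s -> s < 1 ->
  RInt (cauchy_integrand A B r s a 1) 0 (2 * PI)
  = RInt (cauchy_integrand A B r s a 0) 0 (2 * PI).
Proof.
move=> HAB Hr Hs; have [A1 [A2 H]] := HAB.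
pose P (f : R -> R -> R) (l t : R) : R :=
  f (homotopy_x r s a l t) (homotopy_y r s a l t).
(* The real part of [F' s e^(i (t + a))] with [F' = A1 - i A2]; by [kernel_mul] it is the
   [l]-derivative of the integrand. *)
pose g l t := s * (P A1 l t * cos (t + a) + P A2 l t * sin (t + a)).
have Hd l t : - ((1 - s) / 3) < l < 1 + (1 - s) / 3 ->
    is_derive (fun u => cauchy_integrand A B r s a u t) l (g l t).
  move=> Hl; have [_ _ HA HB] := H _ _ (homotopy_in_disc r s a l t Hr Hs Hl).
  have dA := is_derive_comp_2d A (fun u => homotopy_x r s a u t)
    (fun u => homotopy_y r s a u t) _ _ _ _ _ HA
    (is_derive_homotopy_x_l r s a l t) (is_derive_homotopy_y_l r s a l t).
  have dB := is_derive_comp_2d B (fun u => homotopy_x r s a u t)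
    (fun u => homotopy_y r s a u t) _ _ _ _ _ HB
    (is_derive_homotopy_x_l r s a l t) (is_derive_homotopy_y_l r s a l t).
  have [E1 E2] := kernel_mul r s t Hr.
  set L1 := (X in X = _) in E1; set L2 := (X in X = _) in E2.
  have := is_derive_minus _ _ _ _ _
    (is_derive_scal _ _ (1 + kernel_re r s t) _ dA)
    (is_derive_scal _ _ (kernel_im r s t) _ dB).
  have -> : g l t = minus
    (scal (1 + kernel_re r s t)
      (A1 (homotopy_x r s a l t) (homotopy_y r s a l t)
        * (s * cos (t + a) - r * cos a)
       + A2 (homotopy_x r s a l t) (homotopy_y r s a l t)
        * (s * sin (t + a) - r * sin a)))
    (scal (kernel_im r s t)
      (- A2 (homotopy_x r s a l t) (homotopy_y r s a l t)
        * (s * cos (t + a) - r * cos a)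
       + A1 (homotopy_x r s a l t) (homotopy_y r s a l t)
        * (s * sin (t + a) - r * sin a))).
    rewrite /g /P /minus /plus /opp /scal /= /mult /= cos_plus sin_plus.
    transitivity (A1 (homotopy_x r s a l t) (homotopy_y r s a l t)
       * ((s * cos t) * cos a - (s * sin t) * sin a)
      + A2 (homotopy_x r s a l t) (homotopy_y r s a l t)
       * ((s * sin t) * cos a + (s * cos t) * sin a)); first ring.
    by rewrite -E1 -E2 /L1 /L2; ring.
  apply: is_derive_ext => u.
  by rewrite /cauchy_integrand /minus /plus /opp /scal /= /mult /=; ring.
have Hg l t : - ((1 - s) / 3) < l < 1 + (1 - s) / 3 -> continuity_2d_pt g l t.
  move=> Hl; have [H1 H2 _ _] := H _ _ (homotopy_in_disc r s a l t Hr Hs Hl).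
  rewrite /g /P; apply: continuity_2d_pt_mult.
    exact: continuity_2d_pt_const.
  apply: continuity_2d_pt_plus; apply: continuity_2d_pt_mult.
  - exact: continuity_2d_pt_homotopy.
  - exact: (continuity_2d_pt_snd _ _ _ (ex_derive_cos_add a t)).
  - exact: continuity_2d_pt_homotopy.
  - exact: (continuity_2d_pt_snd _ _ _ (ex_derive_sin_add a t)).
(* Differentiation under the integral sign asks for a full neighbourhood of [l], also at [l = 0] and
   [l = 1]. *)
have Hnear l : 0 <= l <= 1 -> locally l
    (fun u : R => - ((1 - s) / 3) < u < 1 + (1 - s) / 3).
  move=> Hl; have He : 0 < (1 - s) / 3 by lra.
  exists (mkposreal _ He) => u.
  by rewrite /ball /= /AbsRing_ball /abs /minus /plus /opp /= => /Rabs_def2; lra.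
have HI l : 0 <= l <= 1 -> is_derive
    (fun u => RInt (cauchy_integrand A B r s a u) 0 (2 * PI)) l
    (RInt (g l) 0 (2 * PI)).
  move=> Hl.
  have -> : RInt (g l) 0 (2 * PI) = RInt (fun t =>
      Derive (fun u => cauchy_integrand A B r s a u t) l) 0 (2 * PI).
    apply: RInt_ext => t _; apply/esym/is_derive_unique; apply: Hd; lra.
  apply: is_derive_RInt_param.
  - by move: (Hnear l Hl); apply: filter_imp => u Hu t _; eexists; apply: Hd.
  - move=> t _; apply: (continuity_2d_pt_ext_loc g); last by apply: Hg; lra.
    have [e He] := Hnear l Hl; exists e => u v Hu _.
    by apply/esym/is_derive_unique/Hd/He.
  - move: (Hnear l Hl); apply: filter_imp => u Hu.
    exact: ex_RInt_cauchy_integrand.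
(* The [t]-derivative of [F] along the circle is [i l s e^(i (t + a)) F'], with imaginary part
   [l g], so the integral vanishes by periodicity of [B]. Dividing by [l] excludes 0, but the mean
   value theorem needs the derivative only in the open interval. *)
have Hg0 l : 0 < l < 1 -> RInt (g l) 0 (2 * PI) = 0.
  move=> Hl; have Hl' : - ((1 - s) / 3) < l < 1 + (1 - s) / 3 by lra.
  apply: is_RInt_unique.
  have E : minus (/ l * P B l (2 * PI)) (/ l * P B l 0) = 0.
    rewrite /P /homotopy_x /homotopy_y (Rplus_comm (2 * PI)) Rplus_0_l.
    rewrite cos_plus sin_plus cos_2PI sin_2PI !Rmult_1_r !Rmult_0_r.
    rewrite Rminus_0_r Rplus_0_r /minus /plus /opp /=.
    by ring.
  rewrite -[X in is_RInt _ _ _ X]E.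
  apply: (is_RInt_derive (fun t => / l * P B l t)) => t _.
    have [_ _ _ HB] := H _ _ (homotopy_in_disc r s a l t Hr Hs Hl').
    have dB := is_derive_comp_2d B (homotopy_x r s a l)
      (homotopy_y r s a l) _ _ _ _ _ HB
      (is_derive_homotopy_x_t r s a l t) (is_derive_homotopy_y_t r s a l t).
    have := is_derive_scal _ _ (/ l) _ dB.
    set v := (X in is_derive _ _ X); have -> : g l t = v.
      by rewrite /v /g /P /scal /= /mult /=; field; lra.
    exact.
  by apply: (continuity_2d_pt_slice g); apply: Hg.
have H01 : Rmin 0 1 = 0 /\ Rmax 0 1 = 1.
  by rewrite Rmin_left ?Rmax_right //; lra.
have [||c [_ E]] := MVT_gen
  (fun u => RInt (cauchy_integrand A B r s a u) 0 (2 * PI)) 0 1 (fun=> 0).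
- rewrite H01.1 H01.2 => l Hl; move: (HI l); rewrite Hg0 // => H0.
  by apply: H0; lra.
- rewrite H01.1 H01.2 => l Hl; apply/continuity_pt_filterlim.
  exact: ex_derive_continuous (ex_intro _ _ (HI l Hl)).
- by move: E; lra.
Qed.

(** At [l = 0] the factor [F] is the constant [F(r e^(i a))], and the two parts of [k] integrate to
    0, so only the summand 1 of [1 + k] contributes. *)
Lemma RInt_cauchy_integrand (A B : R -> R -> R) (r s a : R) :
  holomorphic_pair A B -> 0 <= r < s -> s < 1 ->
  RInt (cauchy_integrand A B r s a 1) 0 (2 * PI)
  = 2 * PI * A (r * cos a) (r * sin a).
Proof.
move=> HAB Hr Hs; rewrite RInt_cauchy_integrand_const //.
apply: is_RInt_unique.
have -> : 2 * PI * A (r * cos a) (r * sin a) =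
    minus (scal (A (r * cos a) (r * sin a)) (plus (2 * PI - 0) 0))
      (scal (B (r * cos a) (r * sin a)) 0).
  by rewrite /minus /plus /opp /scal /= /mult /=; ring.
have := is_RInt_minus _ _ _ _ _ _
  (is_RInt_scal _ _ _ (A (r * cos a) (r * sin a)) _
    (is_RInt_plus _ _ _ _ _ _ (is_RInt_const 0 (2 * PI) (1 : R))
      (is_RInt_kernel_re r s Hr)))
  (is_RInt_scal _ _ _ (B (r * cos a) (r * sin a)) _
      (is_RInt_kernel_im r s Hr)).
have -> : scal (2 * PI - 0) (1 : R) = 2 * PI - 0.
  by rewrite /scal /= /mult /=; ring.
apply: is_RInt_ext => t _.
rewrite /cauchy_integrand /homotopy_x /homotopy_y !Rmult_0_l !Rplus_0_r.
by rewrite /minus /plus /opp /scal /= /mult /=; ring.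
Qed.

(** The formulas for [r e^(i a)] and for 0 sample [F] at the same points of the circle, and [k]
    vanishes for the centre. Their difference is the mean of the real part of [F k], where
    [|k| <= r / (s - r)]. *)
Lemma holomorphic_pair_growth_lt (A B : R -> R -> R) (M r s a : R) :
  holomorphic_pair A B -> 0 <= M ->
  (forall x y, x * x + y * y < 1 ->
    A x y * A x y + B x y * B x y <= M * M) ->
  0 <= r < s -> s < 1 ->
  A (r * cos a) (r * sin a) - A 0 0 <= M * (r / (s - r)).
Proof.
move=> HAB HM Hbound Hr Hs.
have H1 : - ((1 - s) / 3) < 1 < 1 + (1 - s) / 3 by lra.
have H0 : 0 <= 0 < s by lra.
have HPI := PI_RGT_0.
have ex_r := ex_RInt_cauchy_integrand A B r s a 1 HAB Hr Hs H1.
have ex_0 := ex_RInt_cauchy_integrand A B 0 s a 1 HAB H0 Hs H1.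
have E : 2 * PI * (A (r * cos a) (r * sin a) - A 0 0) =
    RInt (fun t => minus (cauchy_integrand A B r s a 1 t)
                     (cauchy_integrand A B 0 s a 1 t)) 0 (2 * PI).
  rewrite RInt_minus // !RInt_cauchy_integrand // !Rmult_0_l.
  by rewrite /minus /plus /opp /=; ring.
apply: (Rmult_le_reg_l (2 * PI)); first lra.
rewrite E; apply: Rle_trans (_ : RInt (fun=> M * (r / (s - r))) 0 (2 * PI) <= _).
  apply: RInt_le; first lra.
  - exact: ex_RInt_minus.
  - exact: ex_RInt_const.
  move=> t _.
  have Hx : homotopy_x r s a 1 t = s * cos (t + a).
    by rewrite /homotopy_x; ring.
  have Hy : homotopy_y r s a 1 t = s * sin (t + a).
    by rewrite /homotopy_y; ring.
  have Hx0 : homotopy_x 0 s a 1 t = s * cos (t + a).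
    by rewrite /homotopy_x; ring.
  have Hy0 : homotopy_y 0 s a 1 t = s * sin (t + a).
    by rewrite /homotopy_y; ring.
  have HAB1 := Hbound _ _ (homotopy_in_disc r s a 1 t Hr Hs H1).
  have Hk := kernel_modulus_le r s t Hr.
  have [k1 k2] : kernel_re 0 s t = 0 /\ kernel_im 0 s t = 0.
    have := kernel_den_pos 0 s t H0.
    by rewrite /kernel_re /kernel_im => HD; split; field; lra.
  rewrite Hx Hy in HAB1.
  rewrite /cauchy_integrand Hx Hy Hx0 Hy0 k1 k2 /minus /plus /opp /=.
  set u := A _ _ in HAB1 *; set v := B _ _ in HAB1 *.
  set p := kernel_re r s t in Hk *; set q := kernel_im r s t in Hk *.
  have Hq : 0 <= r / (s - r) by apply: Rdiv_le_0_compat; lra.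
  set w := r / (s - r) in Hk Hq *.
  have -> : u * (1 + p) - v * q + - (u * (1 + 0) - v * 0) = u * p - v * q.
    by ring.
  apply: Rsqr_incr_0_var; last exact: Rmult_le_pos.
  rewrite /Rsqr.
  have : (u * u + v * v) * (p * p + q * q) <= (M * M) * (w * w).
    by apply: Rmult_le_compat => //; nra.
  (* Lagrange's identity: [(u p - v q)^2 + (u q + v p)^2 = (u^2 + v^2) (p^2 + q^2)]. *)
  have : 0 <= (u * q + v * p) * (u * q + v * p) by apply: Rle_0_sqr.
  lra.
by rewrite RInt_const /scal /= /mult /=; lra.
Qed.

Lemma polar_coordinates (x y r : R) : 0 <= r -> x * x + y * y = r * r ->
  exists a, x = r * cos a /\ y = r * sin a.
Proof.
move=> Hr Hxy; case: (Req_dec r 0) => Hr0.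
  by exists 0; rewrite cos_0 sin_0; nra.
have Hx : -1 <= x / r <= 1.
  have : Rabs x <= Rabs r by apply: Rsqr_le_abs_0; rewrite /Rsqr; nra.
  rewrite (Rabs_pos_eq r) // => /Rabs_le_between Hxr.
  by split; [apply/Rle_div_r|apply/Rle_div_l]; lra.
have Ec : x = r * cos (acos (x / r)) by rewrite cos_acos //; field.
have Es : r * sin (acos (x / r)) = Rabs y.
  rewrite sin_acos //; apply: Rsqr_inj.
  - by apply: Rmult_le_pos => //; apply: sqrt_pos.
  - exact: Rabs_pos.
  rewrite -Rsqr_abs Rsqr_mult Rsqr_sqrt.
    transitivity (r * r - x * x); last by rewrite /Rsqr; lra.
    by rewrite /Rsqr; field.
  have : Rsqr (x / r) <= Rsqr 1.
    by apply: Rsqr_le_abs_1; rewrite Rabs_R1; apply: Rabs_le.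
  by rewrite Rsqr_1; lra.
case: (Rle_lt_dec 0 y) => Hy.
  by exists (acos (x / r)); rewrite Es Rabs_pos_eq.
exists (- acos (x / r)); rewrite cos_neg sin_neg; split=> //.
by rewrite Ropp_mult_distr_r_reverse Es Rabs_left //; ring.
Qed.

(** The radius [s] of the circle tends to 1; the limit is taken in the bound, since nothing is known
    of [F] on the unit circle itself. *)
Lemma holomorphic_pair_growth (A B : R -> R -> R) (M x y r : R) :
  holomorphic_pair A B -> 0 <= M ->
  (forall x y, x * x + y * y < 1 ->
    A x y * A x y + B x y * B x y <= M * M) ->
  0 <= r < 1 -> x * x + y * y = r * r ->
  A x y - A 0 0 <= M * (r / (1 - r)).
Proof.
move=> HAB HM Hbound Hr Hxy.
have [a [-> ->]] := polar_coordinates x y r Hr.1 Hxy.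
set X := _ - _.
have Hs s : r < s < 1 -> X * (s - r) <= M * r.
  move=> Hs; have H : X <= M * (r / (s - r)).
    by apply: (holomorphic_pair_growth_lt A B) => //; lra.
  apply: Rle_trans (_ : M * (r / (s - r)) * (s - r) <= _).
    by apply: Rmult_le_compat_r => //; lra.
  by apply: Req_le; field; lra.
have H1 : X * (1 - r) <= M * r.
  case: (Rle_lt_dec X 0) => HX; first by nra.
  apply: Rnot_lt_le => Hlt.
  (* If [e] is the excess, then [s >= 1 - e / (2 X)] costs at most [e / 2] in [X (s - r)],
     contradicting [Hs]; the other entry of the maximum keeps [s] above [r]. *)
  set e := X * (1 - r) - M * r in Hlt.
  have [H2 H3] : r < Rmax ((1 + r) / 2) (1 - e / (2 * X)) < 1.
    split; first by apply: Rlt_le_trans (Rmax_l _ _); lra.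
    apply: Rmax_lub_lt; first lra.
    have : 0 < e / (2 * X) by apply: Rdiv_lt_0_compat; rewrite /e; lra.
    lra.
  have := Hs _ (conj H2 H3).
  have : X * (1 - e / (2 * X)) <= X * Rmax ((1 + r) / 2) (1 - e / (2 * X)).
    by apply: Rmult_le_compat_l; [lra|apply: Rmax_r].
  have -> : X * (1 - e / (2 * X)) = X - e / 2 by field; lra.
  by rewrite /e; rewrite /e in Hlt; lra.
apply: (Rmult_le_reg_r (1 - r)); first lra.
by apply: Rle_trans H1 _; apply: Req_le; field; lra.
Qed.

(** * Derivatives of planar harmonic maps *)

Lemma in_unit_discE (x y : R) : Cdisc 1 (x, y) <-> x * x + y * y < 1.
Proof.
rewrite /Cdisc /= /Cmod /=.
have -> : x * (x * 1) + y * (y * 1) = x * x + y * y by ring.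
rewrite -{1}sqrt_1; split=> [/sqrt_lt_0_alt//|H].
by apply: sqrt_lt_1_alt; split=> //; nra.
Qed.

Lemma locally_2d_unit_disc (P : R -> R -> Prop) (x y : R) :
  (forall u v, u * u + v * v < 1 -> P u v) -> x * x + y * y < 1 ->
  locally_2d P x y.
Proof.
move=> HP Hxy.
have Hc : continuity_2d_pt (fun u v => u * u + v * v) x y.
  apply: continuity_2d_pt_plus; apply: continuity_2d_pt_mult;
    first [exact: continuity_2d_pt_id1|exact: continuity_2d_pt_id2].
have He : 0 < 1 - (x * x + y * y) by lra.
have [d Hd] := Hc (mkposreal _ He).
exists d => u v Hu Hv; apply: HP.
by have /Rabs_def2 := Hd u v Hu Hv; rewrite /=; lra.
Qed.

Lemma C1_differentiable_pt_lim (f : R -> R -> R) (x y : R) :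
  locally_2d (fun u v => ex_derive (fun t => f t v) u) x y ->
  ex_derive (fun t => f x t) y ->
  continuity_2d_pt (fun u v => Derive (fun t => f t v) u) x y ->
  differentiable_pt_lim f x y
    (Derive (fun t => f t y) x) (Derive (fun t => f x t) y).
Proof.
move=> Hx Hy Hc; apply/filterdiff_differentiable_pt_lim.
apply: (is_derive_filterdiff f x y (fun u v => Derive (fun t => f t v) u)).
- have [d Hd] := Hx; exists d => -[u v] [Hu Hv].
  by apply: Derive_correct; apply: Hd.
- exact: Derive_correct.
- exact: (proj1 (continuity_2d_pt_filterlim
    (fun u v => Derive (fun t => f t v) u) x y) Hc).
Qed.

Lemma differentiable_pt_lim_lincomb (f g : R -> R -> R)
    (x y fx fy gx gy c c' : R) :
  differentiable_pt_lim f x y fx fy -> differentiable_pt_lim g x y gx gy ->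
  differentiable_pt_lim (fun u v => c * f u v + c' * g u v) x y
    (c * fx + c' * gx) (c * fy + c' * gy).
Proof.
apply: (differentiable_pt_lim_comp (fun u v => c * u + c' * v)) => eps.
apply: locally_2d_forall => u v.
set X := (X in Rabs X); have -> : X = 0 by rewrite /X; ring.
rewrite Rabs_R0; apply: Rmult_le_pos; first by apply: Rlt_le; apply: cond_pos.
by apply: Rle_trans (Rmax_l _ _); apply: Rabs_pos.
Qed.

(** The Cauchy-Riemann equations for [u_x - i u_y]: one is the symmetry of the mixed second
    partials, the other is Laplace's equation. The derivative is [u_xx - i u_xy]. *)
Lemma real_harmonic_gradient (u : R -> R -> R) :
  real_harmonic (Cdisc 1) u ->
  holomorphic_pair (fun x y => Derive (fun t => u t y) x)
    (fun x y => - Derive (fun t => u x t) y).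
Proof.
move=> Hu.
pose ux x y := Derive (fun t => u t y) x.
pose uy x y := Derive (fun t => u x t) y.
have H x y : x * x + y * y < 1 -> ex_diff_n u 2 x y.
  by move=> /in_unit_discE /Hu [].
exists (fun x y => Derive (fun t => ux t y) x),
  (fun x y => Derive (fun t => ux x t) y) => x y Hxy.
have [_ [_ [_ [[_ [H1 [H2 [[H3 _] [H4 _]]]]] [_ [H5 [H6 [[H7 _] [H8 _]]]]]]]]]
  := H x y Hxy.
have ES : Derive (fun t => uy t y) x = Derive (fun t => ux x t) y.
  apply: Schwarz => //; apply: locally_2d_unit_disc Hxy => v w /H.
  by move=> [_ [? [? [[_ [? [? _]]] [_ [? [? _]]]]]]].
have EH : Derive (fun t => uy x t) y = - Derive (fun t => ux t y) x.
  have /in_unit_discE /Hu [_] := Hxy.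
  by rewrite /partial_derive /= -/ux -/uy => E; rewrite /ux /uy; lra.
split=> //.
- apply: C1_differentiable_pt_lim => //.
  by apply: locally_2d_unit_disc Hxy => v w /H [_ [_ [_ [[_ []]]]]].
- rewrite -ES.
  have -> : Derive (fun t => ux t y) x = - Derive (fun t => uy x t) y.
    by rewrite EH; ring.
  have Hd : differentiable_pt_lim uy x y (Derive (fun t => uy t y) x)
      (Derive (fun t => uy x t) y).
    apply: C1_differentiable_pt_lim => //.
    by apply: locally_2d_unit_disc Hxy => v w /H [_ [_ [_ [_ [_ []]]]]].
  have := differentiable_pt_lim_lincomb _ _ _ _ _ _ _ _ (-1) 0 Hd Hd.
  rewrite !Rmult_0_l !Rplus_0_r -!Ropp_mult_distr_l !Rmult_1_l.
  apply: differentiable_pt_lim_ext.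
  by apply: locally_2d_forall => v w; rewrite /uy; ring.
Qed.

Lemma holomorphic_pair_lincomb (A B A' B' : R -> R -> R) (c c' : R) :
  holomorphic_pair A B -> holomorphic_pair A' B' ->
  holomorphic_pair (fun x y => c * A x y + c' * A' x y)
    (fun x y => c * B x y + c' * B' x y).
Proof.
move=> [A1 [A2 H]] [A1' [A2' H']].
exists (fun x y => c * A1 x y + c' * A1' x y),
  (fun x y => c * A2 x y + c' * A2' x y) => x y Hxy.
have [c1 c2 dA dB] := H x y Hxy; have [c1' c2' dA' dB'] := H' x y Hxy.
split.
- by apply: continuity_2d_pt_plus; apply: continuity_2d_pt_mult => //;
    apply: continuity_2d_pt_const.
- by apply: continuity_2d_pt_plus; apply: continuity_2d_pt_mult => //;
    apply: continuity_2d_pt_const.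
- exact: differentiable_pt_lim_lincomb.
- have -> : - (c * A2 x y + c' * A2' x y)
    = c * - A2 x y + c' * - A2' x y by ring.
  exact: differentiable_pt_lim_lincomb.
Qed.

Lemma holomorphic_pair_ext (A B A' B' : R -> R -> R) :
  (forall x y, A x y = A' x y) -> (forall x y, B x y = B' x y) ->
  holomorphic_pair A B -> holomorphic_pair A' B'.
Proof.
move=> EA EB [A1 [A2 H]]; exists A1, A2 => x y Hxy.
have [c1 c2 dA dB] := H x y Hxy; split=> //.
- by apply: differentiable_pt_lim_ext dA; apply: locally_2d_forall.
- by apply: differentiable_pt_lim_ext dB; apply: locally_2d_forall.
Qed.

(* Multiplication by [i]. *)
Lemma holomorphic_pair_rot (A B : R -> R -> R) :
  holomorphic_pair A B -> holomorphic_pair (fun x y => - B x y) A.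
Proof.
move=> [A1 [A2 H]]; exists A2, (fun x y => - A1 x y) => x y Hxy.
have [c1 c2 dA dB] := H x y Hxy; split=> //.
- exact: continuity_2d_pt_opp.
- have := differentiable_pt_lim_lincomb _ _ _ _ _ _ _ _ (-1) 0 dB dB.
  rewrite !Rmult_0_l !Rplus_0_r -!Ropp_mult_distr_l !Rmult_1_l Ropp_involutive.
  apply: differentiable_pt_lim_ext.
  by apply: locally_2d_forall => v w; ring.
- by rewrite Ropp_involutive.
Qed.

(* The inner product of [e] with the derivative of [f] at [z] in the direction
   [d]. *)
Definition dir_derive (f : C -> C) (e d z : C) : R :=
  Re e * (Re d * Re (Dx f z) + Im d * Re (Dy f z))
  + Im e * (Re d * Im (Dx f z) + Im d * Im (Dy f z)).

Lemma Cmod_sq (z : C) : Cmod z * Cmod z = Re z * Re z + Im z * Im z.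
Proof. by have := Cmod2_alt z; rewrite /= !Rmult_1_r. Qed.

Lemma Lambda_ge_0 (f : C -> C) (z : C) : 0 <= Lambda f z.
Proof. by apply: Rplus_le_le_0_compat; apply: Cmod_ge_0. Qed.

(** If [(P, Q)] is the gradient of the inner product of a fixed [e] with [f], then
    [P - i Q = conj(e) f_z + e conj(f_zbar)], and the triangle inequality applies. *)
Lemma gradient_le_Lambda (f : C -> C) (e z : C) :
  (Re e * Re (Dx f z) + Im e * Im (Dx f z))
    * (Re e * Re (Dx f z) + Im e * Im (Dx f z))
  + (Re e * Re (Dy f z) + Im e * Im (Dy f z))
    * (Re e * Re (Dy f z) + Im e * Im (Dy f z))
  <= (Cmod e * Lambda f z) * (Cmod e * Lambda f z).
Proof.
set P := Re e * Re (Dx f z) + _; set Q := Re e * Re (Dy f z) + _.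
have E : (P, - Q) = Cplus (Cmult (Cconj e) (Dz f z)) (Cmult e (Cconj (Dzbar f z))).
  rewrite /P /Q /Dz /Dzbar; case: (Dx f z) => a b; case: (Dy f z) => c d.
  by case: e {P Q} => e1 e2; apply: injective_projections => /=; field.
have H : Cmod (P, - Q) <= Cmod e * Lambda f z.
  rewrite E; apply: Rle_trans (Cmod_triangle _ _) _.
  by rewrite (Cmod_mult (Cconj e)) (Cmod_mult e) !Cmod_conj /Lambda; lra.
have -> : P * P + Q * Q = Cmod (P, - Q) * Cmod (P, - Q).
  by rewrite Cmod_sq /=; ring.
by apply: Rmult_le_compat => //; apply: Cmod_ge_0.
Qed.

(** For [P - i Q] as in [gradient_le_Lambda], the directional derivative is the real part of
    [d (P - i Q)]. This product is holomorphic, as a combination of [P - i Q] and its rotation by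
    [i], and is bounded by [|e| |d| M]. *)
Lemma dir_derive_growth (f : C -> C) (M : R) (e d z : C) :
  harmonic_map (Cdisc 1) f ->
  (forall z, Cdisc 1 z -> Lambda f z <= M) -> Cdisc 1 z ->
  dir_derive f e d z - dir_derive f e d (RtoC 0)
  <= Cmod e * Cmod d * M * (Cmod z / (1 - Cmod z)).
Proof.
move=> [HU HV] HM Hz.
have HM0 : 0 <= M.
  by apply: Rle_trans (Lambda_ge_0 f z) (HM _ Hz).
have Hh := holomorphic_pair_lincomb _ _ _ _ (Re e) (Im e)
  (real_harmonic_gradient _ HU) (real_harmonic_gradient _ HV).
have Hd := holomorphic_pair_lincomb _ _ _ _ (Re d) (Im d)
  Hh (holomorphic_pair_rot _ _ Hh).
case: z Hz => x y Hz.
apply: (holomorphic_pair_growth (fun x y => dir_derive f e d (x, y))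
  _ (Cmod e * Cmod d * M) x y (Cmod (x, y)) (holomorphic_pair_ext _ _
  (fun x y => dir_derive f e d (x, y)) _ _ (fun _ _ => erefl _) Hd)).
- by move=> v w; rewrite /dir_derive /Dx /Dy /=; ring.
- by apply: Rmult_le_pos => //; apply: Rmult_le_pos; apply: Cmod_ge_0.
- move=> v w /in_unit_discE Hvw.
  have HG := gradient_le_Lambda f e (v, w).
  have HL : (Cmod e * Lambda f (v, w)) * (Cmod e * Lambda f (v, w))
      <= (Cmod e * M) * (Cmod e * M).
    have H1 : 0 <= Cmod e * Lambda f (v, w).
      by apply: Rmult_le_pos; [apply: Cmod_ge_0|apply: Lambda_ge_0].
    have H2 : Cmod e * Lambda f (v, w) <= Cmod e * M.
      by apply: Rmult_le_compat_l; [apply: Cmod_ge_0|apply: HM].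
    exact: Rmult_le_compat.
  have := Rle_trans _ _ _ HG HL => {HG HL}.
  rewrite /dir_derive /Dx /Dy /=.
  set Ux := Derive _ v; set Vx := Derive _ v.
  set Uy := Derive _ w; set Vy := Derive _ w => H.
  set L := (X in X <= _).
  have -> : L = (Cmod d * Cmod d) *
    ((Re e * Ux + Im e * Vx) * (Re e * Ux + Im e * Vx) +
     (Re e * Uy + Im e * Vy) * (Re e * Uy + Im e * Vy)).
    by rewrite Cmod_sq /L; ring.
  apply: Rle_trans (_ : (Cmod d * Cmod d) * (Cmod e * M * (Cmod e * M)) <= _).
    apply: Rmult_le_compat_l => //.
    exact: Rle_0_sqr.
  by apply: Req_le; ring.
- by split; [apply: Cmod_ge_0|].
- by rewrite Cmod_sq.
Qed.

(** * The remainder [f - Df(0)] along segments *)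

Definition dot (e w : C) : R := Re e * Re w + Im e * Im w.

Definition segment_pt (z d : C) (t : R) : C :=
  (Re z + t * Re d, Im z + t * Im d).

(* The real-linear map [Df(0)]. *)
Definition tangent (f : C -> C) (d : C) : C :=
  Cplus (Cmult (Dz f (RtoC 0)) d) (Cmult (Dzbar f (RtoC 0)) (Cconj d)).

Lemma dot_tangent (f : C -> C) (e d : C) :
  dot e (tangent f d) = dir_derive f e d (RtoC 0).
Proof.
rewrite /dot /tangent /dir_derive /Dz /Dzbar.
case: (Dx f _) => a b; case: (Dy f _) => a' b'; case: e => e1 e2.
by case: d => d1 d2 /=; field.
Qed.

(** Testing with [e = w] suffices. This duality turns bounds on complex increments into scalar ones,
    to which the mean value theorem applies. *)
Lemma Cmod_le_dot (w : C) (k : R) :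
  0 <= k -> (forall e, dot e w <= Cmod e * k) -> Cmod w <= k.
Proof.
move=> Hk /(_ w); rewrite /dot -Cmod_sq.
have := Cmod_ge_0 w; case: (Req_dec (Cmod w) 0) => [-> //|H0 H1 H2].
by apply: (Rmult_le_reg_l (Cmod w)); lra.
Qed.

Lemma real_harmonic_differentiable (u : R -> R -> R) (x y : R) :
  real_harmonic (Cdisc 1) u -> Cdisc 1 (x, y) ->
  differentiable_pt_lim u x y
    (Derive (fun t => u t y) x) (Derive (fun t => u x t) y).
Proof.
move=> Hu Hxy; have [[_ [_ [Hy [[Hc _] _]]]] _] := Hu _ Hxy.
apply: C1_differentiable_pt_lim => //.
apply: locally_2d_unit_disc ((in_unit_discE x y).1 Hxy) => v w.
by move=> /in_unit_discE /Hu [[_ [? _]] _].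
Qed.

Lemma is_derive_segment (f : C -> C) (e z d : C) (t : R) :
  harmonic_map (Cdisc 1) f -> Cdisc 1 (segment_pt z d t) ->
  is_derive (fun t => dot e (f (segment_pt z d t))) t
    (dir_derive f e d (segment_pt z d t)).
Proof.
move=> [HU HV] Ht.
have HP (a b : R) : is_derive (fun t => a + t * b) t b.
  by auto_derive => //; ring.
have dU := is_derive_comp_2d _ (fun t => Re z + t * Re d)
  (fun t => Im z + t * Im d) t _ _ _ _
  (real_harmonic_differentiable _ _ _ HU Ht) (HP _ _) (HP _ _).
have dV := is_derive_comp_2d _ (fun t => Re z + t * Re d)
  (fun t => Im z + t * Im d) t _ _ _ _
  (real_harmonic_differentiable _ _ _ HV Ht) (HP _ _) (HP _ _).
have := is_derive_plus _ _ _ _ _ (is_derive_scal _ _ (Re e) _ dU)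
  (is_derive_scal _ _ (Im e) _ dV).
set l := plus _ _; have -> : l = dir_derive f e d (segment_pt z d t).
  by rewrite /l /dir_derive /Dx /Dy /segment_pt /plus /scal /= /mult /=; ring.
exact.
Qed.

Lemma Cmod_scale (z : C) (t : R) :
  Cmod (segment_pt (RtoC 0) z t) = Rabs t * Cmod z.
Proof.
rewrite -Cmod_R -Cmod_mult; congr Cmod.
by rewrite /segment_pt; apply: injective_projections; rewrite /= /Re /Im; ring.
Qed.

Lemma Cmod_segment_le (z d : C) (t r : R) : 0 <= t <= 1 ->
  Cmod z <= r -> Cmod (Cplus z d) <= r -> Cmod (segment_pt z d t) <= r.
Proof.
move=> Ht Hz Hd.
have -> : segment_pt z d t
    = Cplus (Cmult (RtoC (1 - t)) z) (Cmult (RtoC t) (Cplus z d)).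
  by rewrite /segment_pt; apply: injective_projections; rewrite /= /Re /Im; ring.
apply: Rle_trans (Cmod_triangle _ _) _.
rewrite !Cmod_mult !Cmod_R !Rabs_pos_eq; try lra.
have : (1 - t) * Cmod z <= (1 - t) * r by apply: Rmult_le_compat_l; lra.
have : t * Cmod (Cplus z d) <= t * r by apply: Rmult_le_compat_l; lra.
lra.
Qed.

Lemma div_one_sub_le (x y : R) : 0 <= x <= y -> y < 1 ->
  x / (1 - x) <= y / (1 - y).
Proof.
move=> Hx Hy; apply: Rmult_le_compat; try lra.
  by apply: Rlt_le; apply: Rinv_0_lt_compat; lra.
by apply: Rinv_le_contravar; lra.
Qed.

Lemma le_of_derive_le_0 (F dF : R -> R) :
  (forall t, 0 <= t <= 1 -> is_derive F t (dF t)) ->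
  (forall t, 0 <= t <= 1 -> dF t <= 0) -> F 1 <= F 0.
Proof.
move=> HF Hle.
have H01 : Rmin 0 1 = 0 /\ Rmax 0 1 = 1.
  by rewrite Rmin_left ?Rmax_right //; lra.
have [||c [Hc E]] := MVT_gen F 0 1 dF.
- by rewrite H01.1 H01.2 => t Ht; apply: HF; lra.
- rewrite H01.1 H01.2 => t Ht; apply/continuity_pt_filterlim.
  exact: ex_derive_continuous (ex_intro _ _ (HF t Ht)).
- by rewrite H01.1 H01.2 in Hc; have := Hle c Hc; lra.
Qed.

Section BoundedDilatation.

Variables (f : C -> C) (M : R).
Hypothesis f_harmonic : harmonic_map (Cdisc 1) f.
Hypothesis f_Lambda : forall z, Cdisc 1 z -> Lambda f z <= M.

Lemma Lambda_bound_ge_0 : 0 <= M.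
Proof.
apply: Rle_trans (Lambda_ge_0 f (RtoC 0)) (f_Lambda _ _).
by rewrite /Cdisc /= Cmod_0; lra.
Qed.

Lemma remainder_lipschitz (r : R) (z w : C) :
  0 <= r < 1 -> Cmod z <= r -> Cmod w <= r ->
  Cmod (Cminus (Cminus (f w) (f z)) (tangent f (Cminus w z)))
  <= M * (r / (1 - r)) * Cmod (Cminus w z).
Proof.
move=> Hr Hz Hw; have HM := Lambda_bound_ge_0.
set d := Cminus w z; set k := M * (r / (1 - r)).
have Hk : 0 <= k.
  by apply: Rmult_le_pos => //; apply: Rdiv_le_0_compat; lra.
have Ew : Cplus z d = w.
  by rewrite /d; apply: injective_projections; rewrite /= /Re /Im; ring.
have Hseg t : 0 <= t <= 1 -> Cmod (segment_pt z d t) <= r.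
  by move=> Ht; apply: Cmod_segment_le; rewrite // Ew.
apply: Cmod_le_dot.
  by apply: Rmult_le_pos => //; apply: Cmod_ge_0.
move=> e.
(* Subtracting the linear majorant turns the mean value estimate into monotonicity, [F 1 <= F 0]. *)
pose F t := dot e (f (segment_pt z d t))
  - t * (dir_derive f e d (RtoC 0) + Cmod e * (k * Cmod d)).
have := le_of_derive_le_0 F (fun t => dir_derive f e d (segment_pt z d t)
  - (dir_derive f e d (RtoC 0) + Cmod e * (k * Cmod d))) _ _.
have E1 : segment_pt z d 1 = w.
  by rewrite -Ew /segment_pt; apply: injective_projections; rewrite /= /Re /Im; ring.
have E0 : segment_pt z d 0 = z.
  by rewrite /segment_pt; apply: injective_projections; rewrite /= /Re /Im; ring.
rewrite /F E1 E0 -dot_tangent.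
have -> : dot e (Cminus (Cminus (f w) (f z)) (tangent f d))
    = dot e (f w) - dot e (f z) - dot e (tangent f d).
  by rewrite /dot /= /Re /Im; ring.
move=> H; suff : dot e (f w) - 1 * (dot e (tangent f d) + Cmod e * (k * Cmod d))
  <= dot e (f z) - 0 * (dot e (tangent f d) + Cmod e * (k * Cmod d)) by lra.
apply: H => t Ht.
  have Hd : Cdisc 1 (segment_pt z d t).
    by rewrite /Cdisc /=; have := Hseg t Ht; lra.
  have := is_derive_minus _ _ _ _ _ (is_derive_segment f e z d t f_harmonic Hd)
    (is_derive_scal_l id t 1 (dot e (tangent f d) + Cmod e * (k * Cmod d)) (is_derive_id t)).
  by rewrite /minus /plus /opp /scal /= /mult /= Rmult_1_l dot_tangent.
have Hd : Cdisc 1 (segment_pt z d t).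
  by rewrite /Cdisc /=; have := Hseg t Ht; lra.
have := dir_derive_growth f M e d _ f_harmonic f_Lambda Hd.
rewrite dot_tangent.
have : Cmod e * Cmod d * M
    * (Cmod (segment_pt z d t) / (1 - Cmod (segment_pt z d t)))
    <= Cmod e * (k * Cmod d).
  have -> : Cmod e * (k * Cmod d) = Cmod e * Cmod d * M * (r / (1 - r)).
    by rewrite /k; ring.
  apply: Rmult_le_compat_l.
    by repeat apply: Rmult_le_pos => //; apply: Cmod_ge_0.
  apply: div_one_sub_le; last lra.
  by split; [apply: Cmod_ge_0|apply: Hseg].
lra.
Qed.

(** Sharper than the Lipschitz bound between 0 and [z]: the growth bound varies along the radius and
    is integrated, [M x / (1 - x)] from 0 to [|z|]. This is where the logarithm arises. *)
Lemma remainder_le (z : C) : Cdisc 1 z ->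
  Cmod (Cminus (Cminus (f z) (f (RtoC 0))) (tangent f z))
  <= - (M * (Cmod z + ln (1 - Cmod z))).
Proof.
rewrite /Cdisc /= => Hz; have HM := Lambda_bound_ge_0.
have Hz0 := Cmod_ge_0 z; set r := Cmod z in Hz Hz0 *.
have Hln : r + ln (1 - r) <= 0.
  have := exp_ineq1_le (ln (1 - r)); rewrite exp_ln; lra.
apply: Cmod_le_dot; first by nra.
move=> e.
(* The last term has derivative [- |e| M r (r t / (1 - r t))], exactly opposite to the growth bound
   at modulus [r t]. *)
pose F t := dot e (f (segment_pt (RtoC 0) z t))
  - t * dir_derive f e z (RtoC 0) + Cmod e * M * (r * t + ln (1 - r * t)).
have := le_of_derive_le_0 F
  (fun t => dir_derive f e z (segment_pt (RtoC 0) z t)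
  - dir_derive f e z (RtoC 0) + Cmod e * M * (r - r / (1 - r * t))) _ _.
have E1 : segment_pt (RtoC 0) z 1 = z.
  by rewrite /segment_pt; apply: injective_projections; rewrite /= /Re /Im; ring.
have E0 : segment_pt (RtoC 0) z 0 = RtoC 0.
  by rewrite /segment_pt; apply: injective_projections; rewrite /= /Re /Im; ring.
rewrite /F E1 E0 !Rmult_1_r !Rmult_0_r Rminus_0_r ln_1 -dot_tangent.
have -> : dot e (Cminus (Cminus (f z) (f (RtoC 0))) (tangent f z))
    = dot e (f z) - dot e (f (RtoC 0)) - dot e (tangent f z).
  by rewrite /dot /= /Re /Im; ring.
move=> H.
suff : dot e (f z) - 1 * dot e (tangent f z) + Cmod e * M * (r + ln (1 - r))
  <= dot e (f (RtoC 0)) - 0 * dot e (tangent f z) + Cmod e * M * (0 + 0) by lra.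
have Hrt t : 0 <= t <= 1 -> 0 <= r * t < 1 by nra.
have Hseg t : 0 <= t <= 1 -> Cmod (segment_pt (RtoC 0) z t) = r * t.
  by move=> Ht; rewrite Cmod_scale Rabs_pos_eq; [rewrite /r; ring|lra].
have Hd t : 0 <= t <= 1 -> Cdisc 1 (segment_pt (RtoC 0) z t).
  by move=> Ht; rewrite /Cdisc /= Hseg //; have := Hrt t Ht; lra.
apply: H => t Ht; have Ht' := Hrt t Ht.
  have H1 := is_derive_segment f e (RtoC 0) z t f_harmonic (Hd t Ht).
  have H2 : is_derive (fun t => - (t * dot e (tangent f z))
      + Cmod e * M * (r * t + ln (1 - r * t))) t
    (- dot e (tangent f z) + Cmod e * M * (r - r / (1 - r * t))).
    by auto_derive; [lra|field; lra].
  have := is_derive_plus _ _ _ _ _ H1 H2.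
  rewrite /plus /= -Rplus_assoc; apply: is_derive_ext => u.
  by rewrite /plus /=; ring.
have := dir_derive_growth f M e z _ f_harmonic f_Lambda (Hd t Ht).
rewrite dot_tangent Hseg // -/r.
have -> : Cmod e * M * (r - r / (1 - r * t))
  = - (Cmod e * r * M * (r * t / (1 - r * t))) by field; lra.
lra.
Qed.

End BoundedDilatation.

(** * From almost everywhere to everywhere *)

(** A null set contains no square, since a square of side [2 eps] has measure [(2 eps)^2 > 0]. *)
Lemma ae_lebesgue2_dense (P : plane -> Prop) (x y eps : R) :
  {ae lebesgue2, forall z, P z} -> 0 < eps ->
  exists u v, [/\ Rabs (u - x) < eps, Rabs (v - y) < eps & P (u, v)].
Proof.
move=> [N [mN N0 HN]] Heps; apply: contrapT => Hno.
pose s : R := 2 * eps.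
pose I (c : R) : set (measurableTypeR R) :=
  [set` Interval (BRight (c - eps)) (BLeft (c + eps))]%classic.
have mI c : measurable (I c) by exact: measurable_itv.
have IE c t : I c t -> Rabs (t - c) < eps.
  rewrite /I /= in_itv /= => /andP[/RltP H1 /RltP H2].
  by apply: Rabs_def1; lra.
have HI c : lebesgue1 (I c) = s%:E.
  rewrite /lebesgue1 /I lebesgue_measure_itv /= lte_fin.
  have -> : (c - eps < c + eps)%O by apply/RltP; lra.
  by rewrite EFinN -EFinD; congr EFin; rewrite -RminusE /s; ring.
have sub : ((I x `*` I y) `<=` N)%classic.
  move=> [u v] [/= /IE Hu /IE Hv]; apply: HN => /= HP.
  by apply: Hno; exists u, v.
have : (lebesgue2 (I x `*` I y)%classic <= lebesgue2 N)%E.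
  by apply: le_measure => //; rewrite inE //; exact: measurableX.
have -> : lebesgue2 (I x `*` I y)%classic = (s%:E * s%:E)%E.
  transitivity (lebesgue1 (I x) * lebesgue1 (I y))%E; last by rewrite !HI.
  exact: product_measure1E.
rewrite N0 -EFinM lee_fin => /RleP.
have H : 0 < s * s by apply: Rmult_lt_0_compat; rewrite /s; lra.
exact: (Rlt_not_le _ _ H).
Qed.

Lemma continuity_2d_pt_Cmod (a b : R -> R -> R) (x y : R) :
  continuity_2d_pt a x y -> continuity_2d_pt b x y ->
  continuity_2d_pt (fun u v => Cmod (a u v, b u v)) x y.
Proof.
move=> Ha Hb.
apply: (continuity_1d_2d_pt_comp sqrt (fun u v => a u v ^ 2 + b u v ^ 2)).
  apply: continuity_pt_sqrt.
  by apply: Rplus_le_le_0_compat; apply: pow2_ge_0.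
by apply: continuity_2d_pt_plus; rewrite /=; apply: continuity_2d_pt_mult => //;
  apply: continuity_2d_pt_mult => //; apply: continuity_2d_pt_const.
Qed.

Lemma real_harmonic_C1 (u : R -> R -> R) (x y : R) :
  real_harmonic (Cdisc 1) u -> Cdisc 1 (x, y) ->
  continuity_2d_pt (fun x y => Derive (fun t => u t y) x) x y /\
  continuity_2d_pt (fun x y => Derive (fun t => u x t) y) x y.
Proof.
by move=> Hu /Hu [[_ [_ [_ [[Hx _] [Hy _]]]]] _].
Qed.

Lemma continuity_2d_pt_Dz (f : C -> C) (x y : R) :
  harmonic_map (Cdisc 1) f -> Cdisc 1 (x, y) ->
  continuity_2d_pt (fun u v => Cmod (Dz f (u, v))) x y /\
  continuity_2d_pt (fun u v => Cmod (Dzbar f (u, v))) x y.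
Proof.
move=> [HU HV] Hxy.
have [Ux Uy] := real_harmonic_C1 _ x y HU Hxy.
have [Vx Vy] := real_harmonic_C1 _ x y HV Hxy.
pose half (g : R -> R -> R) (u v : R) := / 2 * g u v.
have H2 (g : R -> R -> R) : continuity_2d_pt g x y ->
    continuity_2d_pt (half g) x y.
  by move=> Hg; apply: continuity_2d_pt_mult => //; apply: continuity_2d_pt_const.
split.
- apply: continuity_2d_pt_ext (continuity_2d_pt_Cmod _ _ _ _
    (H2 _ (continuity_2d_pt_plus _ _ _ _ Ux Vy))
    (H2 _ (continuity_2d_pt_minus _ _ _ _ Vx Uy))) => u v.
  by congr Cmod; rewrite /Dz /Dx /Dy; apply: injective_projections;
    rewrite /half /=; field.
- apply: continuity_2d_pt_ext (continuity_2d_pt_Cmod _ _ _ _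
    (H2 _ (continuity_2d_pt_minus _ _ _ _ Ux Vy))
    (H2 _ (continuity_2d_pt_plus _ _ _ _ Vx Uy))) => u v.
  by congr Cmod; rewrite /Dzbar /Dx /Dy; apply: injective_projections;
    rewrite /half /=; field.
Qed.

(** First partials are continuous, so a strict violation at one point would persist on a small
    square. *)
Lemma elliptic_everywhere (K K' : R) (f : C -> C) (z : C) :
  harmonic_map (Cdisc 1) f -> elliptic K K' f -> Cdisc 1 z ->
  Lambda f z ^ 2 <= K * Jacobian f z + K'.
Proof.
move=> Hf [_ _ _ _ Hae]; case: z => x y Hxy.
have [Ha Hb] := continuity_2d_pt_Dz f x y Hf Hxy.
pose G u v := Lambda f (u, v) ^ 2 - K * Jacobian f (u, v).
have HG : continuity_2d_pt G x y.
  rewrite /G /Lambda /Jacobian /=.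
  by repeat first [exact: Ha | exact: Hb | apply: continuity_2d_pt_minus
    | apply: continuity_2d_pt_plus | apply: continuity_2d_pt_mult
    | apply: continuity_2d_pt_const].
apply: Rnot_lt_le => Hlt.
have He : 0 < G x y - K' by rewrite /G; lra.
have [d Hd] := HG (mkposreal _ He).
have [d' Hd'] : locally_2d (fun u v => Cdisc 1 (u, v)) x y.
  apply: locally_2d_unit_disc ((in_unit_discE x y).1 Hxy) => u v.
  by move=> /in_unit_discE.
have [] := ae_lebesgue2_dense _ x y (Rmin d d') Hae.
  by apply: Rmin_pos; apply: cond_pos.
move=> u [v [Hu Hv HP]].
have HP' := HP (Hd' u v (Rlt_le_trans _ _ _ Hu (Rmin_r _ _))
  (Rlt_le_trans _ _ _ Hv (Rmin_r _ _))).
have /Rabs_def2 := Hd u v (Rlt_le_trans _ _ _ Hu (Rmin_l _ _))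
  (Rlt_le_trans _ _ _ Hv (Rmin_l _ _)).
have : G u v <= K' by rewrite /G; lra.
by move=> + [_ /=]; lra.
Qed.

Lemma elliptic_Lambda_le (K K' lam : R) (f : C -> C) :
  1 <= K -> 0 <= K' -> harmonic_map (Cdisc 1) f -> elliptic K K' f ->
  (forall z, Cdisc 1 z -> lambda f z <= lam) ->
  forall z, Cdisc 1 z -> Lambda f z <= K * lam + sqrt K'.
Proof.
move=> HK HK' Hf Hell Hlam z Hz.
have := elliptic_everywhere K K' f z Hf Hell Hz.
have HJ : Jacobian f z = Lambda f z * (Cmod (Dz f z) - Cmod (Dzbar f z)).
  by rewrite /Jacobian /Lambda; ring.
have Hl : Cmod (Dz f z) - Cmod (Dzbar f z) <= lam.
  by apply: Rle_trans (Hlam z Hz); apply: Rle_abs.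
have Hl0 : 0 <= lam by apply: Rle_trans (Hlam z Hz); apply: Rabs_pos.
have HL := Lambda_ge_0 f z.
have HS := sqrt_pos K'; have HS2 : sqrt K' * sqrt K' = K' by apply: sqrt_def.
rewrite HJ => H.
have H1 : Lambda f z * (Cmod (Dz f z) - Cmod (Dzbar f z)) <= Lambda f z * lam.
  exact: Rmult_le_compat_l.
have H2 : K * (Lambda f z * (Cmod (Dz f z) - Cmod (Dzbar f z)))
    <= K * (Lambda f z * lam) by apply: Rmult_le_compat_l => //; lra.
have H3 : 0 <= K * lam by apply: Rmult_le_pos; lra.
apply: Rnot_lt_le => Hlt.
(* If [Lambda > K lam + sqrt K'], both factors exceed [sqrt K'] or equal more than it, against
   [Lambda^2 <= K lam Lambda + K']. *)
have : Lambda f z * (Lambda f z - K * lam) > sqrt K' * sqrt K'.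
  have : sqrt K' * sqrt K' <= Lambda f z * sqrt K' by nra.
  nra.
by move: H; rewrite /=; lra.
Qed.

(** * Schlicht discs of expanding maps *)

(** Neighbourhoods in [R * R] come from the maximum norm; comparison with [Cmod] costs a factor
    [sqrt 2]. *)
Lemma nbhs_planeP (z : R * R) (A : set (R * R)) :
  nbhs z A <-> exists2 e, 0 < e & forall w, Cmod (Cminus w z) < e -> A w.
Proof.
split=> [/nbhs_ballP[e /= /RltP He HA]|[e He HA]].
- exists e => // w Hw; apply: HA.
  have Hm := Rle_lt_trans _ _ _ (Rmax_Cmod (Cminus w z)) Hw.
  split=> /=.
    apply/RltP; rewrite -RminusE -RabsE /= Rabs_minus_sym.
    exact: Rle_lt_trans (Rmax_l _ _) Hm.
  apply/RltP; rewrite -RminusE -RabsE /= Rabs_minus_sym.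
  exact: Rle_lt_trans (Rmax_r _ _) Hm.
- have H2 : 0 < sqrt 2 by apply: sqrt_lt_R0; lra.
  apply/nbhs_ballP; exists (e / sqrt 2) => /=.
    by apply/RltP; apply: Rdiv_lt_0_compat.
  move=> w [/= /RltP H1' /RltP H2']; apply: HA.
  apply: Rle_lt_trans (Cmod_2Rmax _) _.
  rewrite Rmult_comm; apply/Rlt_div_r => //.
  apply: Rmax_lub_lt => /=.
    by move: H1'; rewrite -RminusE -RabsE Rabs_minus_sym.
  by move: H2'; rewrite -RminusE -RabsE Rabs_minus_sym.
Qed.

Lemma Cmod_sub_sym (z w : C) : Cmod (Cminus z w) = Cmod (Cminus w z).
Proof.
by rewrite -Cmod_opp; congr Cmod; apply: injective_projections => /=; ring.
Qed.

Lemma Cmod_sub_triangle (x y z : C) :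
  Cmod (Cminus x z) <= Cmod (Cminus x y) + Cmod (Cminus y z).
Proof.
apply: Rle_trans (Cmod_triangle _ _); apply: Req_le; congr Cmod.
by apply: injective_projections => /=; ring.
Qed.

Lemma Cmod_rev_triangle (x y : C) : Cmod x - Cmod y <= Cmod (Cminus x y).
Proof.
have := Cmod_triangle (Cminus x y) y.
have -> : Cplus (Cminus x y) y = x.
  by apply: injective_projections => /=; ring.
lra.
Qed.

Lemma closed_disc_compact (r : R) :
  compact.compact ([set z | Cmod z <= r]%classic : set (R * R)).
Proof.
have cbox := compact_setX (@segment_compact R (- r) r)
  (@segment_compact R (- r) r).
apply: subclosed_compact cbox _.
- rewrite -openC openE => z /= /Rnot_le_lt Hz; apply/nbhs_planeP.
  exists (Cmod z - r); first lra.
  move=> w; rewrite Cmod_sub_sym /= => Hw.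
  have := Cmod_rev_triangle z w; lra.
- move=> z /= Hz; have H := Rle_trans _ _ _ (Rmax_Cmod z) Hz.
  have /Rabs_le_between [a b] := Rle_trans _ _ _ (Rmax_l _ _) H.
  have /Rabs_le_between [c d] := Rle_trans _ _ _ (Rmax_r _ _) H.
  rewrite !in_itv /=.
  by split; apply/andP; split; apply/RleP; rewrite -?RoppE.
Qed.

(** The displacement [|Phi z - z|] attains its minimum on the compact disc. Applying [Phi] to the
    minimizer multiplies the displacement by at most [k < 1], so the minimum is 0. *)
Lemma disc_contraction_fixpoint (Phi : C -> C) (r k : R) :
  0 <= r -> 0 <= k < 1 ->
  (forall z, Cmod z <= r -> Cmod (Phi z) <= r) ->
  (forall z w, Cmod z <= r -> Cmod w <= r ->
    Cmod (Cminus (Phi w) (Phi z)) <= k * Cmod (Cminus w z)) ->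
  exists2 z, Cmod z <= r & Phi z = z.
Proof.
move=> Hr Hk Hself Hlip.
pose m (z : R * R) : R := Cmod (Cminus (Phi z) z).
have Hm z w : Cmod z <= r -> Cmod w <= r ->
    m w - m z <= 2 * Cmod (Cminus w z).
  move=> Hz Hw; rewrite /m.
  have H1 := Cmod_sub_triangle (Phi w) (Phi z) w.
  have H2 := Cmod_sub_triangle (Phi z) z w.
  have H3 := Hlip z w Hz Hw; rewrite (Cmod_sub_sym z w) in H2.
  have H4 : k * Cmod (Cminus w z) <= 1 * Cmod (Cminus w z).
    by apply: Rmult_le_compat_r; [apply: Cmod_ge_0|lra].
  lra.
have [||c] := @compact_EVT_min _ R m _ _ (closed_disc_compact r).
- by exists (RtoC 0); rewrite /= Cmod_0.
- apply/subspace_continuousP => z Hz A /nbhs_ballP[e /= /RltP He HA].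
  have {}He : 0 < e := He.
  rewrite /nbhs /= /within; apply/nbhs_planeP.
  exists (e / 2) => [|w Hw Hwr]; first lra.
  have Hzw := Hm _ _ Hz Hwr; have Hwz := Hm _ _ Hwr Hz.
  rewrite (Cmod_sub_sym z w) in Hwz.
  have H : Rabs (m z - m w) < e by apply: Rabs_def1; lra.
  by apply: HA => /=; apply/RltP; rewrite -RabsE -RminusE.
rewrite inE /= => Hc Hmin; exists c => //.
have H1 : m c <= m (Phi c).
  by apply/RleP/Hmin; rewrite inE; apply: Hself.
have H2 := Hlip c (Phi c) Hc (Hself c Hc).
have H0 : m c = 0 by have := Cmod_ge_0 (Cminus (Phi c) c); rewrite /m in H1 *; nra.
have := Cmod_eq_0 _ H0; move=> H.
have -> : Phi c = Cplus (Cminus (Phi c) c) c.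
  by apply: injective_projections => /=; ring.
by rewrite H; apply: injective_projections => /=; ring.
Qed.

(** The constant [c] depends on [r] because it may tend to 0 as [r] approaches [rho]. *)
Definition expanding_inside (rho : R) (f : C -> C) : Prop :=
  forall r, r < rho -> exists2 c, 0 < c &
    forall z w, Cmod z <= r -> Cmod w <= r ->
      c * Cmod (Cminus w z) <= Cmod (Cminus (f w) (f z)).

Lemma expanding_univalent (rho : R) (f : C -> C) :
  expanding_inside rho f -> univalent (Cdisc rho) f.
Proof.
rewrite /Cdisc => Hf z w /= Hz Hw E.
have [c Hc H] := Hf (Rmax (Cmod z) (Cmod w)) (Rmax_lub_lt _ _ _ Hz Hw).
have := H z w (Rmax_l _ _) (Rmax_r _ _).
have -> : Cminus (f w) (f z) = RtoC 0.
  by rewrite E; apply: injective_projections => /=; ring.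
rewrite Cmod_0 => H1; have H2 := Cmod_ge_0 (Cminus w z).
have /Cmod_eq_0 H0 : Cmod (Cminus w z) = 0 by nra.
have -> : w = Cplus (Cminus w z) z.
  by apply: injective_projections => /=; ring.
by rewrite H0; apply: injective_projections => /=; ring.
Qed.

(** The region is the preimage [G] of the disc, with inverse [g]. Connectedness is the main point:
    [G] is the union of the [g]-images of radii, all passing through [g 0], and expansion makes [g]
    Lipschitz along each radius. *)
Lemma expanding_schlicht_disc (f : C -> C) (rho R0 : R) :
  f (RtoC 0) = RtoC 0 -> 0 < rho -> 0 < R0 ->
  (forall z, Cdisc rho z -> {for z, filter.continuous (f : R * R -> R * R)}) ->
  expanding_inside rho f ->
  (forall s, s < R0 -> exists2 r, r < rho &
    forall w, Cmod w <= s -> exists2 z, Cmod z <= r & f z = w) ->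
  has_schlicht_disc f (Cdisc rho) R0.
Proof.
move=> f0 Hrho HR0 Hcont Hexp Hsurj.
have Huniv := expanding_univalent rho f Hexp.
have /choice [g Hg] : forall w, exists z, Cmod w < R0 -> Cmod z < rho /\ f z = w.
  move=> w; case: (Rlt_le_dec (Cmod w) R0) => [Hw|Hw]; last first.
    by exists (RtoC 0); lra.
  have [r Hr /(_ w (Rle_refl _)) [z Hz Ez]] := Hsurj _ Hw.
  by exists z; split=> //; lra.
pose G : set C := [set z | Cmod z < rho /\ Cmod (f z) < R0]%classic.
have GE z : G z -> g (f z) = z.
  by move=> [Hz Hfz]; have [? ?] := Hg _ Hfz; apply: Huniv.
have gG w : Cmod w < R0 -> G (g w).
  by move=> Hw; have [? E] := Hg w Hw; split; rewrite ?E.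
exists (RtoC 0), G; split.
- by move=> z [].
- split.
  + by exists (RtoC 0); rewrite /G /= f0 Cmod_0.
  + rewrite topology_structure.openE => z [Hz Hfz].
    have He1 : 0 < R0 - Cmod (f z) by lra.
    have /(Hcont z Hz)/nbhs_planeP[d Hd H] :
        nbhs (f z) [set w | Cmod w < R0]%classic.
      apply/nbhs_planeP; exists (R0 - Cmod (f z)) => // w Hw /=.
      by have := Cmod_rev_triangle w (f z); lra.
    apply/nbhs_planeP; exists (Rmin d (rho - Cmod z)).
      by apply: Rmin_pos => //; lra.
    move=> w Hw; split.
      have := Cmod_rev_triangle w z; have := Rmin_r d (rho - Cmod z); lra.
    by apply: H; apply: Rlt_le_trans Hw _; apply: Rmin_l.
  + pose path (w : C) (t : R) : R * R := g (Cmult (RtoC t) w).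
    have Hpath w t : 0 <= t <= 1 -> Cmod (Cmult (RtoC t) w) <= Cmod w.
      move=> Ht; rewrite Cmod_mult Cmod_R Rabs_pos_eq; last lra.
      by have := Cmod_ge_0 w; nra.
    pose I01 : set R := [set` Interval (BLeft (0 : R)) (BRight (1 : R))]%classic.
    have itvE (t : R) : I01 t <-> 0 <= t <= 1.
      rewrite /I01 /= in_itv /=; split=> [/andP[/RleP ? /RleP ?] //|[H0 H1]].
      by apply/andP; split; apply/RleP.
    have -> : G = (\bigcup_(w in [set w | Cmod w < R0])
        (path w @` I01))%classic.
      apply/seteqP; split=> z.
        move=> Gz; exists (f z); first by case: Gz.
        exists 1; first by apply/itvE; lra.
        rewrite /path; have -> : Cmult (RtoC 1) (f z) = f z.
          by apply: injective_projections => /=; ring.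
        exact: GE.
      move=> [w /= Hw [t /itvE Ht <-]]; apply: gG.
      by apply: Rle_lt_trans Hw; apply: Hpath.
    apply: bigcup_connected.
      exists (g (RtoC 0)) => w _; exists 0.
        by apply/itvE; lra.
      by rewrite /path; congr g; apply: injective_projections => /=; ring.
    move=> w /= Hw; apply: connected_continuous_connected.
      exact: segment_connected.
    (* One closed disc [|z| <= r] with [r < rho] contains the lift of the whole radius, so a single
       constant [c] serves along it. *)
    have [r Hr Hs] := Hsurj _ Hw; have [c Hc Hexpr] := Hexp r Hr.
    have Hgr t : 0 <= t <= 1 -> Cmod (path w t) <= r.
      move=> Ht; have Htw := Hpath w t Ht.
      have [z Hz Ez] := Hs _ Htw.
      have [H1 H2] := Hg _ (Rle_lt_trans _ _ _ Htw Hw).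
      rewrite /path -(Huniv z (g (Cmult (RtoC t) w))) //.
        by rewrite /Cdisc /=; lra.
      by rewrite Ez H2.
    have Hf t : 0 <= t <= 1 -> f (path w t) = Cmult (RtoC t) w.
      move=> Ht; have Htw := Hpath w t Ht.
      by have [] := Hg _ (Rle_lt_trans _ _ _ Htw Hw).
    apply/subspace_continuousP => t /itvE Ht A /nbhs_planeP[e He HA].
    (* The summand 1 keeps the denominator positive when [w = 0]. *)
    apply/nbhs_ballP; exists (c * e / (Cmod w + 1)).
      apply/RltP; apply: Rdiv_lt_0_compat; first exact: Rmult_lt_0_compat.
      by have := Cmod_ge_0 w; lra.
    move=> s /= Hts /itvE Hst; apply: HA.
    have {}Hts : Rabs (s - t) < c * e / (Cmod w + 1).
      by rewrite Rabs_minus_sym; move: Hts => /RltP; rewrite -RabsE -RminusE.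
    have := Hexpr _ _ (Hgr t Ht) (Hgr s Hst); rewrite !Hf //.
    have -> : Cminus (Cmult (RtoC s) w) (Cmult (RtoC t) w)
        = Cmult (RtoC (s - t)) w.
      by apply: injective_projections => /=; ring.
    rewrite Cmod_mult Cmod_R => H1.
    have Hw0 := Cmod_ge_0 w.
    have H2 : Rabs (s - t) * (Cmod w + 1) < c * e.
      by apply/Rlt_div_r => //; lra.
    have H3 := Rabs_pos (s - t).
    have H4 : Rabs (s - t) * Cmod w <= Rabs (s - t) * (Cmod w + 1).
      by apply: Rmult_le_compat_l; lra.
    apply: (Rmult_lt_reg_l c) => //.
    exact: Rle_lt_trans H1 (Rle_lt_trans _ _ _ H4 H2).
- by move=> z w [Hz _] [Hw _]; apply: Huniv.
- have Ew w : Cminus w (RtoC 0) = w.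
    by apply: injective_projections => /=; ring.
  apply/seteqP; split=> w /=; rewrite Ew.
    by move=> [z [_ Hz] <-].
  by move=> Hw; exists (g w); [apply: gG|have [] := Hg w Hw].
Qed.

(** * Distortion of a normalized harmonic map *)

Lemma tangent_sub (f : C -> C) (z w : C) :
  tangent f (Cminus z w) = Cminus (tangent f z) (tangent f w).
Proof. by rewrite /tangent; apply: injective_projections => /=; ring. Qed.

(** Cramer's rule for [a d + b conj(d) = w] and its conjugate, with determinant [|a|^2 - |b|^2]. *)
Lemma tangent_section (f : C -> C) :
  Cmod (Dzbar f (RtoC 0)) < Cmod (Dz f (RtoC 0)) ->
  exists S, forall w, tangent f (S w) = w.
Proof.
rewrite /tangent; set a := Dz f _; set b := Dzbar f _ => Hab.
have HD : 0 < Re a * Re a + Im a * Im a - (Re b * Re b + Im b * Im b).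
  rewrite -!Cmod_sq; have := Cmod_ge_0 b; nra.
exists (fun w => Cdiv (Cminus (Cmult (Cconj a) w) (Cmult b (Cconj w)))
  (RtoC (Re a * Re a + Im a * Im a - (Re b * Re b + Im b * Im b)))) => w.
move: HD; case: a {Hab} => a1 a2; case: b => b1 b2; case: w => w1 w2 /= HD.
by apply: injective_projections => /=; field; lra.
Qed.

Lemma tangent_expanding (f : C -> C) (d : C) :
  Cmod (Dz f (RtoC 0)) - Cmod (Dzbar f (RtoC 0)) = 1 ->
  Cmod d <= Cmod (tangent f d).
Proof.
move=> H.
have := Cmod_rev_triangle (tangent f d) (Copp (Cmult (Dzbar f (RtoC 0)) (Cconj d))).
have := Cmod_rev_triangle (Cmult (Dz f (RtoC 0)) d)
  (Copp (Cmult (Dzbar f (RtoC 0)) (Cconj d))).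
have -> : Cminus (Cmult (Dz f (RtoC 0)) d)
  (Copp (Cmult (Dzbar f (RtoC 0)) (Cconj d))) = tangent f d.
  by rewrite /tangent; apply: injective_projections => /=; ring.
rewrite Cmod_opp (Cmod_mult (Dz _ _)) (Cmod_mult (Dzbar _ _)) Cmod_conj.
move=> H1 _; apply: Rle_trans H1; apply: Req_le.
by rewrite -Rmult_minus_distr_r H Rmult_1_l.
Qed.

(* The lower bound for [|f z|] at [|z| = x]; its value at [rho1] is
   [schlicht_radius]. *)
Definition lower_profile (M x : R) : R := x + M * (x + ln (1 - x)).

(** The mean value theorem; the derivative [1 - M x / (1 - x)] vanishes at the critical radius
    [1 / (1 + M)]. *)
Lemma lower_profile_increment (M x y : R) :
  1 <= M -> 0 <= x <= y -> y <= 1 / (1 + M) ->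
  exists c, [/\ x <= c, c <= y &
    lower_profile M y - lower_profile M x = (1 - M * (c / (1 - c))) * (y - x)].
Proof.
move=> HM Hx Hy.
have H1 : y < 1.
  by apply: Rle_lt_trans Hy _; apply/Rlt_div_l; lra.
have Hd t : t < 1 ->
    is_derive (lower_profile M) t (1 - M * (t / (1 - t))).
  by move=> Ht; rewrite /lower_profile; auto_derive; [lra|field; lra].
have [Em EM] : Rmin x y = x /\ Rmax x y = y.
  by rewrite Rmin_left ?Rmax_right //; lra.
have [||c] := MVT_gen (lower_profile M) x y (fun t => 1 - M * (t / (1 - t))).
- by rewrite Em EM => t Ht; apply: Hd; lra.
- rewrite Em EM => t Ht; apply/continuity_pt_filterlim.
  apply: (ex_derive_continuous (lower_profile M)).
  by eexists; apply: Hd; lra.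
- by rewrite Em EM => -[[Hc1 Hc2] E]; exists c.
Qed.

Lemma distortion_lt_1 (M r : R) : 1 <= M -> 0 <= r < 1 / (1 + M) ->
  M * (r / (1 - r)) < 1.
Proof.
move=> HM [Hr0 Hr].
have {}Hr : r * (1 + M) < 1 by apply/Rlt_div_r; lra.
have Hr1 : r < 1 by nra.
have -> : M * (r / (1 - r)) = (M * r) / (1 - r) by field; lra.
by apply/Rlt_div_l; lra.
Qed.

Lemma distortion_le_1 (M r : R) : 1 <= M -> 0 <= r <= 1 / (1 + M) ->
  M * (r / (1 - r)) <= 1.
Proof.
move=> HM [Hr0 Hr].
have {}Hr : r * (1 + M) <= 1 by apply/Rle_div_r; lra.
have Hr1 : r < 1 by nra.
have -> : M * (r / (1 - r)) = (M * r) / (1 - r) by field; lra.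
by apply/Rle_div_l; lra.
Qed.

(** The derivative lies between 0 and 1 up to the critical radius. The upper bound by [y - x] gives
    the self-mapping property of the contraction and controls the loss in exhausting the disc. *)
Lemma lower_profile_mono (M x y : R) :
  1 <= M -> 0 <= x <= y -> y <= 1 / (1 + M) ->
  lower_profile M x <= lower_profile M y <= lower_profile M x + (y - x).
Proof.
move=> HM Hx Hy; have [c [Hc1 Hc2 E]] := lower_profile_increment M x y HM Hx Hy.
have H1 : M * (c / (1 - c)) <= 1 by apply: distortion_le_1; lra.
have Hy1 : y < 1 by apply: Rle_lt_trans Hy _; apply/Rlt_div_l; lra.
have H0 : 0 <= M * (c / (1 - c)).
  by apply: Rmult_le_pos; [lra|apply: Rdiv_le_0_compat; lra].
by split; nra.
Qed.

Lemma lower_profile_pos (M : R) : 1 <= M -> 0 < lower_profile M (1 / (1 + M)).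
Proof.
move=> HM; set rho := 1 / (1 + M).
have Hrho : 0 < rho by apply: Rdiv_lt_0_compat; lra.
have L0 : lower_profile M 0 = 0.
  by rewrite /lower_profile Rminus_0_r ln_1; ring.
(* Stopping at [rho / 2] keeps the mean slope strictly positive, whereas it may only be nonnegative
   at [rho]. *)
have [c [Hc1 Hc2 E]] : exists c, [/\ 0 <= c, c <= rho / 2 &
    lower_profile M (rho / 2) - lower_profile M 0
    = (1 - M * (c / (1 - c))) * (rho / 2 - 0)].
  by apply: lower_profile_increment; rewrite // -?/rho; lra.
have H1 : M * (c / (1 - c)) < 1.
  by apply: distortion_lt_1; rewrite // -/rho; lra.
have [H2 _] : lower_profile M (rho / 2) <= lower_profile M rho
    <= lower_profile M (rho / 2) + (rho - rho / 2).
  by apply: lower_profile_mono; rewrite // -?/rho; lra.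
by rewrite L0 in E; nra.
Qed.

Section NormalizedAtOrigin.

Variables (f : C -> C) (M : R).
Hypothesis f_harmonic : harmonic_map (Cdisc 1) f.
Hypothesis f_Lambda : forall z, Cdisc 1 z -> Lambda f z <= M.
Hypothesis f_0 : f (RtoC 0) = RtoC 0.
Hypothesis f_dilatation_0 :
  Cmod (Dz f (RtoC 0)) - Cmod (Dzbar f (RtoC 0)) = 1.

Lemma Lambda_bound_ge_1 : 1 <= M.
Proof.
apply: Rle_trans (f_Lambda (RtoC 0) _).
  rewrite /Lambda; have := Cmod_ge_0 (Dzbar f (RtoC 0)); lra.
by rewrite /Cdisc /= Cmod_0; lra.
Qed.

Let rho := 1 / (1 + M).

Lemma rho_bounds : 0 < rho < 1.
Proof.
have HM := Lambda_bound_ge_1; split; first by apply: Rdiv_lt_0_compat; lra.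
by apply/Rlt_div_l; lra.
Qed.

Lemma normalized_expanding : expanding_inside rho f.
Proof.
have HM := Lambda_bound_ge_1; have Hrho := rho_bounds.
move=> r Hr; case: (Rle_lt_dec 0 r) => Hr0; last first.
  (* No point has modulus at most a negative [r], so any positive constant serves. *)
  by exists 1 => [|z w Hz]; [lra|have := Cmod_ge_0 z; lra].
exists (1 - M * (r / (1 - r))).
  by have := distortion_lt_1 M r HM (conj Hr0 Hr); lra.
move=> z w Hz Hw.
have Hr1 : 0 <= r < 1 by lra.
have H1 := remainder_lipschitz f M f_harmonic f_Lambda r z w Hr1 Hz Hw.
have H2 := tangent_expanding f (Cminus w z) f_dilatation_0.
have := Cmod_rev_triangle (tangent f (Cminus w z)) (Cminus (f w) (f z)).
rewrite (Cmod_sub_sym (tangent _ _)); lra.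
Qed.

Lemma normalized_surjective (r : R) (w : C) : 0 <= r < rho ->
  Cmod w <= lower_profile M r -> exists2 z, Cmod z <= r & f z = w.
Proof.
have HM := Lambda_bound_ge_1; have Hrho := rho_bounds.
move=> Hr Hw.
have [|S HS] := tangent_section f; first lra.
pose E z := Cminus (Cminus (f z) (f (RtoC 0))) (tangent f z).
have Hk : 0 <= M * (r / (1 - r)) < 1.
  split; last exact: distortion_lt_1.
  by apply: Rmult_le_pos; [lra|apply: Rdiv_le_0_compat; lra].
have Hr1 : 0 <= r < 1 by lra.
have [|z z' Hz Hz'|z Hz Ez] :=
  disc_contraction_fixpoint (fun z => S (Cminus w (E z))) r _ Hr.1 Hk.
- move=> z Hz; apply: Rle_trans (tangent_expanding f _ f_dilatation_0) _.
  rewrite HS; apply: Rle_trans (Cmod_triangle _ _) _; rewrite Cmod_opp.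
  have Hz1 : Cdisc 1 z by rewrite /Cdisc /=; lra.
  have HE := remainder_le f M f_harmonic f_Lambda z Hz1.
  (* The remainder bound is [|z| - lower_profile M |z|], so [|w| + |E z| <= r] is the upper half of
     [lower_profile_mono]. *)
  have [_] : lower_profile M (Cmod z) <= lower_profile M r
      <= lower_profile M (Cmod z) + (r - Cmod z).
    apply: lower_profile_mono => //; last by rewrite -/rho; lra.
    by split=> //; apply: Cmod_ge_0.
  by move: HE; rewrite -/(E z) {1}/lower_profile; rewrite /lower_profile in Hw *; lra.
(* [S] is 1-Lipschitz because [tangent f] is additive, expands, and undoes [S]. *)
- apply: Rle_trans (tangent_expanding f _ f_dilatation_0) _.
  rewrite tangent_sub !HS.
  apply: Rle_trans (remainder_lipschitz f M f_harmonic f_Lambda r z z' Hr1 Hz Hz').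
  rewrite Cmod_sub_sym tangent_sub /E; apply: Req_le; congr Cmod.
  by apply: injective_projections => /=; ring.
- exists z => //.
  have : tangent f z = Cminus w (E z) by rewrite -{1}Ez HS.
  rewrite /E f_0 => H.
  have -> : f z = Cplus (Cminus (Cminus (f z) (RtoC 0)) (tangent f z)) (tangent f z).
    by apply: injective_projections => /=; ring.
  by rewrite {2}H; apply: injective_projections => /=; ring.
Qed.

Lemma normalized_schlicht_disc :
  (forall z, Cdisc 1 z -> {for z, filter.continuous (f : R * R -> R * R)}) ->
  has_schlicht_disc f (Cdisc rho) (lower_profile M rho).
Proof.
have HM := Lambda_bound_ge_1; have Hrho := rho_bounds.
move=> Hcont; apply: expanding_schlicht_disc => //.
- exact: Hrho.1.
- exact: lower_profile_pos.
- by move=> z Hz; apply: Hcont; rewrite /Cdisc /= in Hz *; lra.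
- exact: normalized_expanding.
(* Shrinking the radius by [e] lowers the profile by at most [e <= lower_profile M rho - s]; the cap
   [rho] keeps the radius nonnegative. *)
- move=> s Hs; pose e := Rmin (lower_profile M rho - s) rho.
  have He : 0 < e <= rho.
    by split; [apply: Rmin_pos; lra|apply: Rmin_r].
  have He' : e <= lower_profile M rho - s by apply: Rmin_l.
  exists (rho - e); first lra.
  move=> w Hw; apply: normalized_surjective; first lra.
  have [_] : lower_profile M (rho - e) <= lower_profile M rho
      <= lower_profile M (rho - e) + (rho - (rho - e)).
    by apply: lower_profile_mono; rewrite // -?/rho; lra.
  lra.
Qed.

End NormalizedAtOrigin.

Theorem theorem2p5 (K K' lam : R) (f h g : C -> C)
  (hK : 1 <= K) (hK' : 0 <= K')
  (hh : analytic (Cdisc 1) h) (hg : analytic (Cdisc 1) g)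
  (hf : forall z : C, Cdisc 1 z -> f z = Cplus (h z) (Cconj (g z)))
  (hharm : harmonic_map (Cdisc 1) f)
  (hell : elliptic K K' f)
  (hf0 : f (RtoC 0) = RtoC 0)
  (hl0 : lambda f (RtoC 0) = 1)
  (hl : forall z : C, Cdisc 1 z -> lambda f z <= lam) :
  univalent (Cdisc (rho1 K K' lam)) f /\
  has_schlicht_disc f (Cdisc (rho1 K K' lam)) (schlicht_radius K K' lam).
Proof.
set M := K * lam + sqrt K'.
have HL : forall z, Cdisc 1 z -> Lambda f z <= M.
  exact: elliptic_Lambda_le.
(* Positivity of the Jacobian at 0 fixes the sign under the absolute value in [lambda]. *)
have H0 : Cmod (Dz f (RtoC 0)) - Cmod (Dzbar f (RtoC 0)) = 1.
  have [_ Hsp _ _ _] := hell.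
  have : 0 < Jacobian f (RtoC 0).
    by apply: Hsp; rewrite /Cdisc /= Cmod_0; lra.
  rewrite -hl0 /lambda /Jacobian => HJ; rewrite Rabs_pos_eq //.
  have := Cmod_ge_0 (Dz f (RtoC 0)); have := Cmod_ge_0 (Dzbar f (RtoC 0)).
  nra.
have HM := Lambda_bound_ge_1 f M HL H0.
have Erho : rho1 K K' lam = 1 / (1 + M) by rewrite /rho1 /M Rplus_assoc.
have -> : schlicht_radius K K' lam = lower_profile M (1 / (1 + M)).
  rewrite /schlicht_radius Erho -/M /lower_profile.
  have -> // : M * (1 / (1 + M)) = 1 - 1 / (1 + M) by field; lra.
rewrite Erho; split.
- by apply: expanding_univalent; apply: normalized_expanding.
- by apply: normalized_schlicht_disc => //; case: hell.
Qed.
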